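(* If $G\in\mathcal{C}_n^{t,k}$, i.e. $G$ is a cactus of order $n$ with exactly $k$ cycles and exactly $t$ pendant edges, then $$\mathrm{gp}(G)\le \max\{3,\,2k+t\},$$ and equality holds if and only if all cycles of $G$ are good.
   Context: All graphs are finite, simple and undirected. For a connected graph $G$, $d_G(u,v)$ is the number of edges of a shortest $(u,v)$-path, and a $(u,v)$-path of length $d_G(u,v)$ is a $u,v$-geodesic. A set $R\subseteq V(G)$ is a general position set if no three (distinct) vertices of $R$ lie on a common geodesic. A largest general position set is a gp-set, and its cardinality is $\mathrm{gp}(G)$. A connected graph is a cactus if each of its blocks is either a cycle or a cut edge, and any two cycles have no common edges. $\mathcal{C}_n^{t,k}$ is the class of all cacti of order $n$ with $k$ cycles and $t$ pendant edges. A cycle of $G$ having exactly one cut vertex of $G$ is called an end-block. Let $C_\ell=u_1u_2\cdots u_\ell u_1$ be a cycle of the cactus $G$. Two vertices $u_i,u_j$ of $C_\ell$ split $C_\ell$ into two $(u_i,u_j)$-paths. If all other cut vertices of $G$ lying on $C_\ell$ belong to one of these two paths, that path is called a $(u_i,u_j)$-cut-path, and $d_c(u_i,u_j)$ denotes its number of edges. Put $D_c=\min_{u_i,u_j\in V(C_\ell)} d_c(u_i,u_j)$. The cycle $C_\ell$ is good if $D_c\le \frac{\ell}{2}-2$ when $\ell$ is even, or $D_c\le \lfloor\frac{\ell}{2}\rfloor-1$ when $\ell$ is odd. A cycle that is an end-block is (by convention) a good cycle.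
   Formalization: The bound is proved for all cacti; the equality criterion excludes paths (k=0, t≤2: gp=2<3 though all cycles are vacuously good) and the triangle C_3 (gp=3=max{3,2}, but D_c=1>0 and no cut vertex, so not good), exactly where it fails. *)

(* Defs.v *)
From mathcomp Require Import all_boot.
Set Implicit Arguments.
Unset Strict Implicit.
Unset Printing Implicit Defensive.

(* A simple graph is given by its adjacency relation [e], assumed symmetric
   and irreflexive in the theorem. *)
Section Graph.
Variables (V : finType) (e : rel V).
Implicit Types (x y z u v : V) (p c : seq V) (A B R : {set V}).

Definition graph_path u p v : bool :=
  [&& path e u p, uniq (u :: p) & last u p == v].

Definition has_path_of_length u v m : bool :=
  [exists p : m.-tuple V, graph_path u p v].

(* A path has fewer than [#|V|] edges; [dist u v = #|V|] exactly when no
   (u,v)-path exists. *)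
Definition dist u v : nat := find (has_path_of_length u v) (iota 0 #|V|).

Definition geodesic u p v : bool := graph_path u p v && (size p == dist u v).

Definition on_common_geodesic x y z : bool :=
  [exists u, exists v, exists m : 'I_#|V|, exists p : m.-tuple V,
    geodesic u p v && [&& x \in u :: p, y \in u :: p & z \in u :: p]].

Definition general_position R : bool :=
  [forall x in R, forall y in R, forall z in R,
    [&& x != y, y != z & x != z] ==> ~~ on_common_geodesic x y z].

Definition gp : nat := \max_(R : {set V} | general_position R) #|R|.

Definition edges : {set {set V}} := [set [set x; y] | x in V, y in V & e x y].

Definition edges_in A : {set {set V}} := [set E in edges | E \subset A].

Definition degree x : nat := #|[set y | e x y]|.

Definition pendant_edges : {set {set V}} :=
  [set E in edges | [exists x in E, degree x == 1]].

Definition connected_in A : bool :=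
  [forall u in A, forall v in A,
    connect [rel x y | [&& x \in A, y \in A & e x y]] u v].

Definition connected : bool := (0 < #|V|) && connected_in [set: V].

(* Cut vertex of the subgraph induced by [A], when the latter is connected. *)
Definition cut_vertex_in A x : bool := (x \in A) && ~~ connected_in (A :\ x).

Definition cut_vertex x : bool := cut_vertex_in [set: V] x.

Definition cut_edge x y : bool :=
  e x y && ~~ connect [rel u v | e u v && ([set u; v] != [set x; y])] x y.

Definition nonseparable B : bool :=
  [&& B != set0, connected_in B & [forall x, ~~ cut_vertex_in B x]].

(* Blocks are induced subgraphs, hence determined by their vertex sets. *)
Definition block B : bool := maxset nonseparable B.

(* A cycle, listed as u_1, ..., u_l from some starting point and in one of the
   two directions. *)
Definition is_cycle c : bool := (2 < size c) && ucycleb e c.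

Definition cycle_edges c : {set {set V}} := [set [set x; next c x] | x in c].

(* The cycles as subgraphs: distinct listings of one cycle give one element. *)
Definition cycles : {set {set {set V}}} :=
  [set C | [exists m : 'I_#|V|.+1, exists c : m.-tuple V,
             is_cycle c && (C == cycle_edges c)]].

Definition cactus : Prop :=
  [/\ connected,
      forall B, block B ->
        (exists c, [/\ is_cycle c, B = [set x in c]
                     & edges_in B = cycle_edges c])
        \/ (exists x y, B = [set x; y] /\ cut_edge x y)
    & forall C1 C2, C1 \in cycles -> C2 \in cycles -> C1 != C2 ->
        [disjoint C1 & C2]].

Definition cactus_class (n t k : nat) : Prop :=
  [/\ cactus, #|V| = n, #|cycles| = k & #|pendant_edges| = t].

Definition end_block c : bool := count cut_vertex c == 1.

(* [rcons (arc c x y) y] is the (x,y)-path of the cycle [c] that follows the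
   order of [c], and it has [size (arc c x y)] edges; the other (x,y)-path is
   the reverse of [rcons (arc c y x) x].  The endpoints lie on the path, so the
   condition only bears on the other cut vertices. *)
Definition cut_path c x y : bool :=
  [&& x \in c, y \in c, x != y
    & all (fun z => cut_vertex z ==> (z \in rcons (arc c x y) y)) c].

(* All cut-paths have fewer than [size c] edges, and going from a vertex all
   the way round to its predecessor is one, so the neutral element [size c] is
   never the minimum.  When both paths between two vertices are cut-paths, both
   count. *)
Definition Dc c : nat :=
  \big[minn/size c]_(x in c)
    \big[minn/size c]_(y in c | cut_path c x y) size (arc c x y).

(* No truncation occurs in the subtractions, since a cycle has length >= 3. *)
Definition good_cycle c : bool :=
  end_block c ||
  (if odd (size c) then Dc c <= (size c)./2 - 1 else Dc c <= (size c)./2 - 2).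

End Graph.

(* Main.v *)
Require Import Defs.
From mathcomp Require Import all_boot zify.

Set Implicit Arguments.
Unset Strict Implicit.
Unset Printing Implicit Defensive.

(** Three vertices lie on a common geodesic exactly when the distances of two
   of the three pairs add up to the distance of the third pair, so general
   position is a property of the metric ([general_positionP]).

   The metric of a cactus is understood one cycle at a time.  Delete the edges
   of a cycle [c]: each remaining component contains exactly one vertex of [c],
   since a path outside [c] between two vertices of [c] would close up with an
   arc of [c] to a second cycle sharing edges with [c] ([no_ear]).  Call the
   vertex of [c] in the component of [x] the gate of [x].  A path between
   vertices with different gates goes from its origin to the first gate, round
   [c] to the second gate and on to its end ([dist_gate]).  A vertex of [c] is
   a cut vertex if and only if it is the gate of another vertex.  Whether a
   vertex of [c] lies on a geodesic is thus a question about arc lengths.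

   Upper bound.  A cut vertex [w] in a general position set [R] has all of the
   rest of [R] on one side, and can be exchanged for a non-cut vertex of
   another side ([general_position_replace]).  So [R] may be assumed to consist
   of non-cut vertices.  Each of these is a leaf or lies on exactly one cycle
   ([noncut_place]).  If [R] has more than three elements, at most two of them
   lie on any one cycle ([general_position_cycle]), hence
   [#|R| <= 2 * k + t].

   Equality.  When [#|R| = 2 * k + t > 3], every leaf is in [R] and every cycle
   has two vertices [a], [b] in [R].  Every branch at a cycle contains a leaf or
   a whole cycle, so it meets [R]; that no geodesic between branches, or from a
   branch to [a] or [b], contains [a] or [b] inside forces the cut vertices of
   the cycle onto an arc of [m] edges with [2 * m + 3] at most the length of the
   cycle, which is goodness ([good_of_general_position]).  Conversely, on a good
   cycle the two vertices next to the ends of such an arc are on no geodesic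
   that joins two branches, or one of them to a branch
   ([good_free_pair]); all these pairs and all leaves are in general position
   ([good_general_position]).

   When [2 * k + t <= 3] and there is a cycle, it is the only one.  With one
   pendant edge it is an end-block; without, it is the whole graph, and then
   being good and having three vertices in general position both mean, for a
   length other than three, that the length is at least five. *)

Section CactusGraph.

Variables (V : finType) (e : rel V).
Hypotheses (esym : symmetric e) (eirr : irreflexive e) (conn : connected e).
Hypothesis edges_disj : forall C1 C2,
  C1 \in cycles e -> C2 \in cycles e -> C1 != C2 -> [disjoint C1 & C2].
Implicit Types (u v w x y z : V) (p c : seq V) (H R : {set V}).

(** * Geodesics and betweenness *)

Local Notation d := (dist e).

Lemma connected_connect u v : connect e u v.
Proof.
case/andP: conn => _ /forallP/(_ u); rewrite inE /= => /forallP/(_ v).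
rewrite inE /=; apply: connect_sub => {}u {}v /= /and3P[_ _ euv].
exact: connect1.
Qed.

Lemma has_path_of_lengthP u v m :
  reflect (exists p, graph_path e u p v /\ size p = m)
          (has_path_of_length e u v m).
Proof.
apply: (iffP existsP) => [[p Hp] | [p [Hp sp]]].
  by exists p; split=> //; rewrite size_tuple.
by move/eqP: sp => sp; exists (Tuple sp).
Qed.

Lemma graph_path_size u p v : graph_path e u p v -> size p < #|V|.
Proof.
case/and3P=> _ Up _; have := max_card [in u :: p].
by rewrite (card_uniqP Up).
Qed.

Lemma has_dist u v : has (has_path_of_length e u v) (iota 0 #|V|).
Proof.
have /connectP[p ep ->] := connected_connect u v.
case/shortenP: ep => q eq Uq _.
have Hq : graph_path e u q (last u q) by apply/and3P; split.
apply/hasP; exists (size q); last by apply/has_path_of_lengthP; exists q.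
by rewrite mem_iota /= add0n (graph_path_size Hq).
Qed.

Lemma dist_ltn u v : d u v < #|V|.
Proof. by have := has_dist u v; rewrite has_find size_iota. Qed.

Lemma dist_le_path u p : path e u p -> d u (last u p) <= size p.
Proof.
case/shortenP=> q eq Uq /uniq_leq_size qp.
have Hq : graph_path e u q (last u q) by apply/and3P; split.
apply: leq_trans (qp _); last by case/andP: Uq.
 rewrite leqNgt; apply/negP => /(before_find 0).
rewrite nth_iota ?add0n ?(graph_path_size Hq) // => /has_path_of_lengthP.
by case; exists q.
Qed.

Lemma dist_geodesic u v : exists p, geodesic e u p v.
Proof.
have := nth_find 0 (has_dist u v); rewrite -/(dist e u v).
rewrite nth_iota ?dist_ltn // add0n => /has_path_of_lengthP[p [Hp sp]].
by exists p; rewrite /geodesic Hp sp eqxx.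
Qed.

Lemma dist_path u v :
  exists p, [/\ path e u p, last u p = v & size p = d u v].
Proof.
have [p /andP[/and3P[ep _ /eqP lp] /eqP sp]] := dist_geodesic u v.
by exists p.
Qed.

Lemma distxx x : d x x = 0.
Proof. by apply/eqP; rewrite -leqn0 (@dist_le_path x [::]). Qed.

Lemma dist_eq0 x y : (d x y == 0) = (x == y).
Proof.
apply/eqP/eqP => [|->]; last exact: distxx.
have [p [_ <- <-]] := dist_path x y.
by move/size0nil=> ->.
Qed.

Lemma dist_gt0 x y : x != y -> 0 < d x y.
Proof. by rewrite lt0n dist_eq0. Qed.

Lemma dist_sub_path u p v q w :
  path e u p -> last u p = v -> path e v q -> last v q = w ->
  d u w <= size p + size q.
Proof.
move=> ep lp eq lq; rewrite -size_cat -lq -lp -last_cat.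
by apply: dist_le_path; rewrite cat_path ep lp.
Qed.

Lemma dist_triangle x y z : d x z <= d x y + d y z.
Proof.
have [p [ep lp <-]] := dist_path x y; have [q [eq lq <-]] := dist_path y z.
exact: dist_sub_path lq.
Qed.

Lemma dist_sym_le x y : d x y <= d y x.
Proof.
have [p [ep lp <-]] := dist_path y x.
have := @dist_le_path x (rev (belast y p)).
rewrite -lp rev_path size_rev size_belast => /(_ _).
have -> : last (last y p) (rev (belast y p)) = y.
  by case: p {ep lp} => //= z p; rewrite rev_cons last_rcons.
by apply; rewrite (eq_path (e' := e)) // => u v; rewrite esym.
Qed.

Lemma dist_sym x y : d x y = d y x.
Proof. by apply/eqP; rewrite eqn_leq !dist_sym_le. Qed.

Lemma dist_edge x y : e x y -> d x y <= 1.
Proof. by move=> exy; apply: (@dist_le_path x [:: y]); rewrite /= exy. Qed.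

Lemma dist_step x y : x != y -> exists2 z, e x z & d x y = (d z y).+1.
Proof.
move=> nxy; have [[|z p] [/= + lp sp]] := dist_path x y.
  by rewrite lp eqxx in nxy.
case/andP=> exz ep; exists z => //.
have := dist_triangle x z y; have := dist_edge exz; have := dist_le_path ep.
by rewrite lp -sp; lia.
Qed.

Lemma dist_nth u p i j :
  path e u p -> i <= j <= size p ->
  d (nth u (u :: p) i) (nth u (u :: p) j) <= j - i.
Proof.
move=> /(pathP u) ep /andP[lij]; rewrite -(subnKC lij) addKn.
elim: (j - i) => [|m IHm] lp; first by rewrite addn0 distxx.
have /ep/dist_edge em : i + m < size p by rewrite -addnS.
apply: leq_trans (dist_triangle _ (nth u (u :: p) (i + m)) _) _.
by rewrite addnS -[m.+1]addn1 leq_add // IHm // ltnW // -addnS.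
Qed.

Definition between x y z : bool := d x y + d y z == d x z.

(** A shorter way between two vertices of a geodesic would shorten all of it. *)
Lemma geodesic_dist u p v i j :
  geodesic e u p v -> i <= j <= size p ->
  d (nth u (u :: p) i) (nth u (u :: p) j) = j - i.
Proof.
case/andP=> /and3P[ep _ /eqP lp] /eqP sp lij; case/andP: (lij) => li lj.
apply/eqP; rewrite eqn_leq dist_nth //=.
have d0 := @dist_nth u p 0 i ep (leq_trans li lj).
have := @dist_nth u p j (size p) ep; rewrite lj leqnn => /(_ isT).
have -> : nth u (u :: p) (size p) = v by rewrite (nth_last u (u :: p)).
have := dist_triangle u (nth u (u :: p) i) v.
have := dist_triangle (nth u (u :: p) i) (nth u (u :: p) j) v.
by move: d0 li lj; rewrite [nth u _ 0]/= subn0 -sp; lia.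
Qed.

(** Geodesics from [x] to [y] and from [y] to [z] concatenate to a walk of
   length [d x z] when [y] is between [x] and [z]; a walk that short repeats no
   vertex. *)
Lemma on_common_geodesicP x y z :
  x != y -> y != z -> x != z ->
  reflect [\/ between x y z, between y z x | between z x y]
          (on_common_geodesic e x y z).
Proof.
move=> nxy nyz nxz; apply: (iffP idP).
  case/existsP=> u /existsP[v /existsP[m /existsP[p /andP[Gp]]]].
  move: (val p) Gp => {}p Gp /and3P[px py pz].
  have pos w (H : w \in u :: p) :
      exists2 i, i <= size p & w = nth u (u :: p) i.
    exists (index w (u :: p)); last by rewrite nth_index.
    by move: H; rewrite -index_mem.
  have [[i li xi] [[j lj yj] [k lk zk]]] := (pos _ px, (pos _ py, pos _ pz)).
  have D a b : a <= size p -> b <= size p ->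
      d (nth u (u :: p) a) (nth u (u :: p) b) = (a - b) + (b - a).
    move=> la lb; case: (leqP a b) => [ab | /ltnW ba].
      by rewrite (geodesic_dist Gp) ?ab // (eqP ab).
    by rewrite dist_sym (geodesic_dist Gp) ?ba // (eqP ba) addn0.
  have nij : i != j by apply: contraNneq nxy; rewrite xi yj => ->.
  have njk : j != k by apply: contraNneq nyz; rewrite yj zk => ->.
  have nik : i != k by apply: contraNneq nxz; rewrite xi zk => ->.
  rewrite /between xi yj zk !D //.
  have : (i < j < k) || (k < j < i) \/ (j < i < k) || (k < i < j)
      \/ (i < k < j) || (j < k < i) by clear -nij njk nik; lia.
  by case=> [|[]] H; [apply: Or31 | apply: Or33 | apply: Or32];
    clear -H; lia.
move=> H.
have {H} [a [b [w [B mem]]]] : exists a b w : V, between a b w /\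
   forall s : seq V, [&& a \in s, b \in s & w \in s] ->
     [&& x \in s, y \in s & z \in s].
  case: H => B; [exists x, y, z | exists y, z, x | exists z, x, y];
    by split=> // s /and3P[-> -> ->].
have [p [ep lp sp]] := dist_path a b; have [q [eq lq sq]] := dist_path b w.
have lpq : last a (p ++ q) = w by rewrite last_cat lp.
have epq : path e a (p ++ q) by rewrite cat_path ep lp.
have spq : size (p ++ q) = d a w by rewrite size_cat sp sq (eqP B).
have Gpq : graph_path e a (p ++ q) w.
  apply/and3P; split=> //; last exact/eqP.
  case/shortenP: (epq) (lpq) => r er Ur rpq lr.
  apply: (leq_size_uniq Ur) => [t|]; last first.
    by rewrite /= ltnS spq -lr dist_le_path.
  by rewrite !inE => /orP[-> //|/rpq ->]; rewrite orbT.
have spqV := graph_path_size Gpq.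
apply/existsP; exists a; apply/existsP; exists w; apply/existsP.
exists (Ordinal spqV); apply/existsP; exists (in_tuple (p ++ q)).
rewrite /= /geodesic Gpq spq eqxx /=; apply: mem.
by rewrite mem_head -lpq mem_last -cat_cons mem_cat -lp mem_last.
Qed.

Lemma general_positionP R :
  reflect {in R & &, forall x y z, x != y -> y != z -> x != z ->
             ~~ between x y z}
          (general_position e R).
Proof.
apply: (iffP idP) => [gpR x y z xR yR zR nxy nyz nxz | btw].
  move/forall_inP: gpR => /(_ _ xR)/forall_inP/(_ _ yR)/forall_inP/(_ _ zR).
  rewrite nxy nyz nxz /=; apply: contra => B.
  by apply/on_common_geodesicP => //; apply: Or31.
apply/forall_inP=> x xR; apply/forall_inP=> y yR; apply/forall_inP=> z zR.
apply/implyP=> /and3P[nxy nyz nxz]; apply/negP => /on_common_geodesicP.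
move=> /(_ nxy nyz nxz) [|B|B].
- by apply/negP; apply: btw.
- by move: B; apply/negP; apply: btw; rewrite // eq_sym.
- by move: B; apply/negP; apply: btw; rewrite // eq_sym.
Qed.


(** * Non-cut vertices *)

Definition avoid w : rel V := [rel u v | [&& u != w, v != w & e u v]].

Lemma avoid_sym w : symmetric (avoid w).
Proof. by move=> u v; rewrite /avoid /= esym andbCA. Qed.

Lemma avoid_connect_sym w : connect_sym (avoid w).
Proof. exact: sym_connect_sym (avoid_sym w). Qed.

Lemma cut_vertexPn w :
  reflect (forall u v, u != w -> v != w -> connect (avoid w) u v)
          (~~ cut_vertex e w).
Proof.
rewrite /cut_vertex /cut_vertex_in inE /= negbK.
have eqc : connect [rel x y | [&& x \in setT :\ w, y \in setT :\ w & e x y]]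
           =2 connect (avoid w).
  by apply: eq_connect => x y; rewrite /= !inE !andbT.
apply: (iffP forall_inP) => [C u v uw vw | C u].
  have /C/forall_inP/(_ v) : u \in setT :\ w by rewrite !inE uw.
  by rewrite !inE vw eqc; apply.
rewrite !inE andbT => uw; apply/forall_inP=> v; rewrite !inE andbT => vw.
by rewrite eqc C.
Qed.

Lemma noncut_root w r :
  (forall u, u != w -> connect (avoid w) u r) -> ~~ cut_vertex e w.
Proof.
move=> C; apply/cut_vertexPn => u v uw vw.
by apply: connect_trans (C u uw) _; rewrite avoid_connect_sym C.
Qed.

(** Following a geodesic towards [w] one step at a time, a vertex [v] can only
   be met when it is strictly nearer to [w]; hence a vertex that is farthest
   from [w] in a set that can be left only through [w] separates nothing. *)
Lemma farthest_noncut w v H :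
    v \in H -> w \notin H ->
    (forall x y, x \in H -> e x y -> y != w -> y \in H) ->
    (forall x, x \in H -> d x w <= d v w) ->
  ~~ cut_vertex e v.
Proof.
move=> vH wH clH far.
have wv : w != v by apply: contraNneq wH => ->.
apply: (@noncut_root v w) => u.
have [m] := ubnP (d u w); elim: m u => // m IHm u; rewrite ltnS => lem uv.
have [-> //| uw] := eqVneq u w.
have [z euz dz] := dist_step uw.
have zv : z != v.
  apply/eqP => zv; rewrite {z}zv in euz dz *.
  have uH : u \in H by apply: clH uw => //; first exact: vH; rewrite esym.
  by have := far u uH; rewrite dz ltnn.
apply: connect_trans (IHm z _ zv); last by rewrite -ltnS -dz ltnS.
by apply: connect1; rewrite /avoid /= uv zv.
Qed.

Lemma exists_noncut w H :
    H != set0 -> w \notin H ->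
    (forall x y, x \in H -> e x y -> y != w -> y \in H) ->
  exists2 v, v \in H & ~~ cut_vertex e v.
Proof.
case/set0Pn=> x0 x0H wH clH.
case: (arg_maxnP (fun x => d x w) x0H) => v vH far.
by exists v => //; apply: farthest_noncut vH wH clH far.
Qed.

Lemma between_cut w u v :
  u != w -> v != w -> ~~ connect (avoid w) u v -> between u w v.
Proof.
move=> uw vw Nuv.
have [p [ep lp sp]] := dist_path u v.
case: (boolP (w \in p)) => [/splitPr wp | wp].
  case: wp ep lp sp => p1 p2; rewrite cat_path last_cat size_cat /=.
  case/and3P=> e1 e1w e2 lp sp; rewrite /between -sp eqn_leq sp dist_triangle andbT.
  rewrite -sp -addSnnS leq_add //; last by rewrite -lp dist_le_path.
  have := @dist_le_path u (rcons p1 w); rewrite rcons_path e1 last_rcons.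
  by rewrite size_rcons; apply.
case/negP: Nuv; apply/connectP; exists p => //.
elim: p u uw ep wp {lp sp} => //= x p IHp u uw /andP[eux ep].
rewrite inE negb_or eq_sym => /andP[xw wp].
by rewrite /avoid /= uw xw eux IHp.
Qed.

Lemma connect_avoid_neq w u v : u != w -> connect (avoid w) u v -> v != w.
Proof.
move=> uw /connectP[p]; elim: p u uw => [|x p IHp] u uw /=; first by move=> _ ->.
by case/andP=> /and3P[_ xw _] /(IHp x xw).
Qed.

(** When [R] is in general position and [w] in [R] is a cut vertex, all of [R]
   but [w] lies on one side of [w]: two vertices on different sides would have
   [w] between them.  On another side there is a non-cut vertex [v], and [v]
   can play the part of [w], as every geodesic from [v] to [R] starts by going
   to [w]. *)
Lemma general_position_replace R w :
    general_position e R -> w \in R -> cut_vertex e w ->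
  exists v, [/\ v \notin R, ~~ cut_vertex e v &
                general_position e (v |: R :\ w)].
Proof.
move=> /general_positionP gpR wR cw.
have [u [v [uw vw Nuv]]] : exists u v,
    [/\ u != w, v != w & ~~ connect (avoid w) u v].
  pose P u v := [&& u != w, v != w & ~~ connect (avoid w) u v].
  have [/existsP[u /existsP[v /and3P[uw vw Nuv]]] | Nex] :=
    boolP [exists u, exists v, P u v]; first by exists u, v.
  suff: ~~ cut_vertex e w by rewrite cw.
  apply/cut_vertexPn => u v uw vw; apply: contraR Nex => Nuv.
  by apply/existsP; exists u; apply/existsP; exists v; rewrite /P uw vw.
pose H x := [set y | connect (avoid w) x y].
have [x xw disj] : exists2 x, x != w & [disjoint H x & R].
  case: (boolP [disjoint H u & R]) => [?|/pred0Pn[a /andP[aH aR]]].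
    by exists u.
  exists v => //; rewrite disjoints_subset; apply/subsetP => b bH.
  rewrite inE; apply/negP=> bR; rewrite !inE in aH bH.
  have aw := connect_avoid_neq uw aH; have bw := connect_avoid_neq vw bH.
  have Nab : ~~ connect (avoid w) a b.
    apply: contra Nuv => ab; apply: connect_trans aH (connect_trans ab _).
    by rewrite avoid_connect_sym.
  have ab : a != b by apply: contraNneq Nab => ->.
  have := gpR a w b aR wR bR aw; rewrite eq_sym bw ab => /(_ isT isT).
  by rewrite between_cut.
have [|||y yH Ncy] := @exists_noncut w (H x).
- by apply/set0Pn; exists x; rewrite inE connect0.
- by rewrite inE; apply/negP => /(connect_avoid_neq xw); rewrite eqxx.
- move=> a b; rewrite !inE => xa eab bw; apply: connect_trans (xa) _.
  by apply: connect1; rewrite /avoid /= bw eab andbT (connect_avoid_neq xw xa).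
have HR a : a \in H x -> a \notin R by move=> aH; rewrite (disjointFr disj aH).
exists y; rewrite HR //; split=> //.
have xy : connect (avoid w) x y by rewrite inE in yH.
have yw := connect_avoid_neq xw xy.
have dy a : a \in R :\ w -> d y a = d y w + d w a /\ d y w > 0.
  rewrite !inE => /andP[aw aR]; split; last exact: dist_gt0.
  apply/eqP; rewrite eq_sym; apply: between_cut => //.
  apply: contraL aR => ya; apply: HR; rewrite inE.
  exact: connect_trans ya.
apply/general_positionP => a b c.
have neq a' : a' \in R :\ w -> a' != w by rewrite !inE => /andP[].
have inR a' : a' \in R :\ w -> a' \in R by rewrite !inE => /andP[].
rewrite !in_setU1.
case/orP=> [/eqP-> | aR]; case/orP=> [/eqP-> | bR]; case/orP=> [/eqP-> | cR];
  rewrite ?eqxx // => nab nbc nac; rewrite /between.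
- have [-> _] := dy b bR; have [-> _] := dy c cR.
  have := gpR w b c wR (inR _ bR) (inR _ cR); rewrite eq_sym.
  rewrite (neq _ bR) [w == c]eq_sym (neq _ cR) => /(_ isT nbc isT).
  by rewrite /between -addnA eqn_add2l.
- have [E1 yw0] := dy a aR; have [E2 _] := dy c cR.
  rewrite (dist_sym a y) E1 E2 neq_ltn; apply/orP; right.
  have := dist_triangle a w c; rewrite (dist_sym a w).
  by move: yw0; clear; lia.
- rewrite (dist_sym b y) (dist_sym a y).
  have [-> _] := dy b bR; have [-> _] := dy a aR.
  have := gpR w b a wR (inR _ bR) (inR _ aR); rewrite [w == b]eq_sym.
  rewrite (neq _ bR) [w == a]eq_sym (neq _ aR) [b == a]eq_sym.
  move=> /(_ isT nab isT); apply: contra => /eqP H1; rewrite /between.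
  by apply/eqP; move: H1; rewrite (dist_sym a b); clear; lia.
- by apply: gpR => //; apply: inR.
Qed.

Lemma general_position_noncut R :
  general_position e R ->
  exists R', [/\ general_position e R', #|R'| = #|R| &
                 forall x, x \in R' -> ~~ cut_vertex e x].
Proof.
have [m] := ubnP #|[set x in R | cut_vertex e x]|.
elim: m R => // m IHm R; rewrite ltnS => lem gpR.
have [/exists_inP[w wR cw] | noc] := boolP [exists w in R, cut_vertex e w].
  have [v [vR Ncv gpR']] := general_position_replace gpR wR cw.
  have vRw : v \notin R :\ w by rewrite !inE (negPf vR) andbF.
  have [|R' [gR' cR' nR']] := IHm (v |: R :\ w) _ gpR'.
    apply: leq_trans lem; apply: proper_card; apply/properP; split.
      apply/subsetP => x; rewrite !inE.
      case/andP=> /orP[/eqP-> | /andP[_ ->] -> //].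
      by rewrite (negPf Ncv).
    exists w; rewrite !inE ?wR // eqxx /= orbF.
    by apply/negP=> /andP[/eqP wv]; rewrite -wv wR in vR.
  by exists R'; split=> //; rewrite cR' cardsU1 vRw (cardsD1 w R) wR.
exists R; split=> // x xR; apply: contra noc => cx.
by apply/exists_inP; exists x.
Qed.
(** * Cycles *)

(** Two neighbours of [v] are joined by a path that avoids [v]; it closes up
   through [v]. *)
Lemma noncut_on_cycle v :
  ~~ cut_vertex e v -> 1 < degree e v -> exists2 c, is_cycle e c & v \in c.
Proof.
move=> /cut_vertexPn Ncv /card_gt1P[y [z []]]; rewrite !inE => evy evz nyz.
have irr x : e v x -> x != v.
  by move=> evx; apply: contraTneq evx => ->; rewrite eirr.
have /connectP[p py lp] := Ncv y z (irr y evy) (irr z evz).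
case/shortenP: py lp => q qy Uq _ zq.
have [eq vq] : path e y q /\ v \notin y :: q.
  have := irr y evy; elim: q y qy {Uq evy zq nyz} => [|x q IHq] y /=.
    by rewrite inE eq_sym.
  case/andP=> /and3P[_ xv eyx] /IHq/(_ xv)[eq vq] yv.
  by rewrite eyx eq inE negb_or eq_sym yv.
exists [:: v, y & q]; last exact: mem_head.
rewrite /is_cycle /ucycleb /= evy rcons_path eq -zq esym evz /= vq.
by case: q zq Uq {qy eq vq} => // zy; rewrite zy eqxx in nyz.
Qed.

Lemma cyclesP C :
  reflect (exists2 c, is_cycle e c & C = cycle_edges c) (C \in cycles e).
Proof.
rewrite inE; apply: (iffP existsP) => [[m /existsP[c /andP[Cc /eqP->]]]|].
  by exists c.
case=> c Cc ->; have Uc : uniq c by case/and3P: Cc.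
have szc : size c < #|V|.+1 by rewrite ltnS -(card_uniqP Uc) max_card.
exists (Ordinal szc); apply/existsP; exists (in_tuple c).
by rewrite Cc eqxx.
Qed.

Lemma is_cycle_rot m c : is_cycle e (rot m c) = is_cycle e c.
Proof. by rewrite /is_cycle /ucycleb size_rot rot_cycle rot_uniq. Qed.

Lemma cycle_edges_rot m c : uniq c -> cycle_edges (rot m c) = cycle_edges c.
Proof.
move=> Uc; apply/setP=> E; apply/imsetP/imsetP => [] [x xc ->].
  by exists x; rewrite ?next_rot // -(mem_rot m).
by exists x; rewrite ?next_rot ?mem_rot.
Qed.

Lemma cycle_edges_catC p c :
  uniq (p ++ c) -> cycle_edges (p ++ c) = cycle_edges (c ++ p).
Proof. by move=> U; rewrite -rot_size_cat cycle_edges_rot // uniq_catC. Qed.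

Lemma head_cycle_edge x c :
  c != [::] -> [set x; head x c] \in cycle_edges (x :: c).
Proof.
by case: c => // y c _; apply/imsetP; exists x; rewrite ?mem_head //= eqxx.
Qed.

Lemma cycle_edge_mem c x y : [set x; y] \in cycle_edges c -> x \in c.
Proof.
case/imsetP=> z zc Exy; have : x \in [set z; next c z] by rewrite -Exy set21.
by rewrite !inE => /orP[]/eqP-> //; rewrite mem_next.
Qed.

Lemma cover_cycle_edges c : cover (cycle_edges c) = [set x in c].
Proof.
apply/setP=> x; rewrite inE; apply/bigcupP/idP => [[E /imsetP[y yc ->]] | xc].
  by rewrite !inE => /orP[]/eqP-> //; rewrite mem_next.
by exists [set x; next c x]; rewrite ?set21 //; apply/imsetP; exists x.
Qed.

(** * Gates *)

Definition off c : rel V :=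
  fun x y => e x y && ([set x; y] \notin cycle_edges c).

Lemma off_sym c : symmetric (off c).
Proof. by move=> x y; rewrite /off esym setUC. Qed.

Lemma off_connect_sym c : connect_sym (off c).
Proof. exact: sym_connect_sym (off_sym c). Qed.

(** A path [p] outside [c] between two vertices of [c] closes up with an arc of
   [c] into a second cycle, which shares with [c] the edges of that arc.  The
   arc may be a single edge, and then [p] is not empty, because the edge from
   [u] to [w] is one of [c]. *)
Lemma no_ear w q2 u q1 p (c := w :: q2 ++ u :: q1) :
  is_cycle e c -> path (off c) u (rcons p w) -> uniq (u :: rcons p w) ->
  ~~ has (mem c) p -> False.
Proof.
move=> Cc Pp Up pc; have /and3P[szc Pc Uc] := Cc.
pose c' := u :: p ++ w :: q2.
have e_p : path e u (rcons p w).
  by apply: sub_path Pp => x y /andP[].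
have [off_u] : [set u; head w p] \notin cycle_edges c.
  by move: Pp; case: (p) => [|y p'] /= /andP[/andP[_ ->]].
have Uc' : uniq c'.
  have := Uc; rewrite /c -cat_cons cat_uniq => /and3P[Uq2 /hasPn Dq _].
  rewrite /c' -cat_cons cat_uniq Uq2 andbT.
  have -> : uniq (u :: p) by move: Up; rewrite -rcons_cons rcons_uniq => /andP[].
  rewrite andTb; apply/hasPn=> x xq2; rewrite inE negb_or; apply/andP; split.
    by apply: contraTneq xq2 => ->; apply: Dq; apply: mem_head.
  have xc : x \in c by rewrite /c -cat_cons mem_cat xq2.
  by apply: contraTN xc => xp; apply: (hasPn pc).
have wu_edge : q2 = [::] -> [set w; u] \in cycle_edges c.
  by move=> q20; rewrite /c q20; apply: (@head_cycle_edge w).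
have Cc' : is_cycle e c'.
  rewrite /is_cycle /ucycleb Uc' andbT; apply/andP; split.
    move: off_u wu_edge; rewrite /c' /= size_cat /=.
    case: (p) (q2) => [|? ?] [|? ?] //=; rewrite ?addnS //.
    by move=> /negPf off_u /(_ erefl); rewrite setUC off_u.
  rewrite /c' /= rcons_cat rcons_cons -cat_rcons cat_path e_p last_rcons.
  rewrite rcons_path.
  by move: Pc; rewrite /c /= rcons_cat cat_path /= => /and3P[-> -> _].
have Dcc' : cycle_edges c != cycle_edges c'.
  apply: contraNneq off_u => ->; rewrite /c'.
  have := @head_cycle_edge u (p ++ w :: q2); case: (p) => [|y p'] /=; exact.
have disj : [disjoint cycle_edges c & cycle_edges c'].
  by apply: edges_disj => //; apply/cyclesP; [exists c | exists c'].
have wc : [set w; head u q2] \in cycle_edges c.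
  by rewrite /c; case: (q2) => [|y q]; apply: (@head_cycle_edge w).
have := disjointFr disj wc; rewrite /c' -cat_cons cycle_edges_catC //.
by case: (q2) => [|y q] /negP[]; apply: (@head_cycle_edge w).
Qed.

Lemma off_connect_eq c u v :
  is_cycle e c -> u \in c -> v \in c -> connect (off c) u v -> u = v.
Proof.
move=> Cc uc vc /connectP[p Pp lp]; apply/eqP; apply: contraT => nuv.
case/shortenP: Pp lp => {}p Pp Up _ lp.
have hp : has (mem c) p.
  apply/hasP; exists v => //; rewrite lp.
  case: p lp {Pp Up} => [|x p] /= lp; last exact: mem_last.
  by rewrite lp eqxx in nuv.
case/split_find: hp Pp Up {lp} => w p1 p2 wc hp1.
rewrite cat_path -cat_cons cat_uniq => /andP[Pp _] /andP[Up _].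
have [i c' rc] := rot_to wc.
have Uc : uniq c by case/and3P: Cc.
have uc' : u \in c'.
  have : u \in rot i c by rewrite mem_rot.
  rewrite rc inE => /orP[/eqP uw|//].
  by move: Up; rewrite uw /= mem_rcons mem_head.
case/splitPr: uc' rc => q2 q1 rc.
case: (@no_ear w q2 u q1 p1); rewrite -?rc ?is_cycle_rot //.
  by rewrite /off cycle_edges_rot.
by rewrite (eq_has (a2 := mem c)) // => x; rewrite /= mem_rot.
Qed.

Section Gate.

Variables (c : seq V).
Hypothesis Cc : is_cycle e c.

Let Uc : uniq c. Proof. by case/and3P: Cc. Qed.
Let szc : 2 < size c. Proof. by case/andP: Cc. Qed.

(** Sending a vertex to its gate retracts the graph onto [c]: an edge is either
   contracted or an edge of [c].  The default [x] is never taken, see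
   [gateP]. *)
Definition gate x : V := odflt x [pick y in c | connect (off c) x y].

Lemma gateP x : (gate x \in c) && connect (off c) x (gate x).
Proof.
rewrite /gate; case: pickP => [//|no]; exfalso.
have [y0 y0c] : exists y0, y0 \in c.
  by case: (c) szc => // y ? _; exists y; apply: mem_head.
have /connectP[p ep lp] := connected_connect x y0; rewrite lp in y0c.
have [y yc xy] : exists2 y, y \in c & connect (off c) x y.
  elim: p x ep y0c {no lp} => [|z p IHp] x /=; first by exists x.
  case/andP=> exz ep lp; have [y yc zy] := IHp z ep lp.
  have [xz | ] := boolP (off c x z).
    by exists y => //; apply: connect_trans zy; apply: connect1.
  rewrite /off exz /= negbK => /cycle_edge_mem xc.
  by exists x.
by have := no y; rewrite yc xy.
Qed.

Lemma gate_mem x : gate x \in c. Proof. by case/andP: (gateP x). Qed.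

Lemma gate_connect x : connect (off c) x (gate x).
Proof. by case/andP: (gateP x). Qed.

Lemma gate_unique x y : y \in c -> connect (off c) x y -> gate x = y.
Proof.
move=> yc xy; apply: (@off_connect_eq c); rewrite ?gate_mem //.
by apply: connect_trans xy; rewrite off_connect_sym gate_connect.
Qed.

Lemma gate_id x : x \in c -> gate x = x.
Proof. by move=> xc; apply: gate_unique; rewrite ?connect0. Qed.

Lemma gate_eq_mem x : (gate x == x) = (x \in c).
Proof. by apply/eqP/idP => [<-|/gate_id]; rewrite ?gate_mem. Qed.

Lemma gate_off x y : connect (off c) x y -> gate x = gate y.
Proof.
move=> xy; apply: gate_unique; rewrite ?gate_mem //.
exact: connect_trans xy (gate_connect y).
Qed.

Lemma edge_gate x y :
  e x y -> gate x = gate y \/ [set x; y] \in cycle_edges c.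
Proof.
move=> exy; have [xy|] := boolP (off c x y).
  by left; apply: gate_off; apply: connect1.
by rewrite /off exy /= negbK; right.
Qed.

(** The only edges that change the gate are those of [c], and so [x] leaves its
   branch only through its gate. *)
Lemma cut_on_cycle x : gate x != x -> cut_vertex e (gate x).
Proof.
move=> gx; apply/negPn/negP => /cut_vertexPn Ncut.
have [y yc ygx] : exists2 y, y \in c & y != gate x.
  case: (c) szc Uc => [|a [|b c']] //= _ /andP[]; rewrite !inE negb_or.
  move=> /andP[ab _] _; have [ga | na] := eqVneq a (gate x).
    by exists b; rewrite -?ga ?inE ?eqxx ?orbT // eq_sym.
  by exists a; rewrite ?inE ?eqxx.
have /connectP[p] : connect (avoid (gate x)) x y by apply: Ncut; rewrite // eq_sym.
move=> ep lp; suff : gate (last x p) = gate x.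
  by rewrite -lp gate_id // => yx; rewrite yx eqxx in ygx.
have: forall a, gate a = gate x -> path (avoid (gate x)) a p ->
    gate (last a p) = gate x; last exact.
elim: p {ep lp} => //= z p IHp a ga.
case/andP=> /and3P[nag nzg eaz] ep; apply: IHp => //.
have [<- //|az] := edge_gate eaz.
by move: nag; rewrite -ga gate_id ?eqxx // (cycle_edge_mem az).
Qed.

(** If [x] is the gate of no other vertex, then without [x] every vertex still
   reaches its gate, and the rest of [c] is a path. *)
Lemma cut_gate x :
  cut_vertex e x -> x \in c -> exists2 y, gate y = x & y != x.
Proof.
move=> cx xc; have [/existsP[y /andP[/eqP gy yx]] | no] :=
  boolP [exists y, (gate y == x) && (y != x)]; first by exists y.
have gate_neq y : y != x -> gate y != x.
  move=> yx; apply: contraNneq no => gy; apply/existsP; exists y.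
  by rewrite gy eqxx.
suff: ~~ cut_vertex e x by rewrite cx.
have [i s rc] := rot_to xc.
have [r [s' Ds]] : exists r s', s = r :: s'.
  have := szc; rewrite -(size_rot i) rc.
  by case: s {rc} => [//|r s'] _; exists r, s'.
have := Cc; rewrite -(is_cycle_rot i) rc Ds => /and3P[_ Prs Urs].
have {}Prs : path e r s' by move: Prs; rewrite /= rcons_path => /and3P[].
have {Urs} xs : x \notin r :: s' by case/andP: Urs.
have {Prs} arc_r y : y \in r :: s' -> connect (avoid x) r y.
  suff/path_connect : path (avoid x) r s' by apply.
  elim: s' r xs Prs {rc Ds} => //= z s' IHs r xs /andP[erz Ps].
  have [rx xs'] : r != x /\ x \notin z :: s'.
    by move: xs; rewrite in_cons negb_or eq_sym => /andP[].
  rewrite (IHs z xs' Ps) /avoid /= rx erz.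
  by move: xs'; rewrite inE negb_or eq_sym => /andP[-> _].
have to_gate p u : path (off c) u p -> gate u != x ->
    connect (avoid x) u (last u p).
  have neq_gate a : gate a != x -> a != x.
    by apply: contraNneq => ->; rewrite gate_id.
  elim: p u => //= z p IHp u /andP[uz zp] gux.
  have gz : gate u = gate z by apply: gate_off; apply: connect1.
  apply: connect_trans (IHp z zp _); last by rewrite -gz.
  have zx : z != x by apply: neq_gate; rewrite -gz.
  by apply: connect1; case/andP: uz => euz _; rewrite /avoid /= neq_gate // zx.
apply: (@noncut_root x r) => u ux.
have gux := gate_neq u ux.
have /connectP[p Pp lp] := gate_connect u.
have ug := to_gate p u Pp gux; rewrite -lp in ug.
apply: connect_trans ug _; rewrite avoid_connect_sym; apply: arc_r.
have : gate u \in rot i c by rewrite mem_rot gate_mem.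
by rewrite rc Ds in_cons (negPf gux).
Qed.

(** ** Distances seen from a cycle *)

Definition pos x : nat := index (gate x) c.

(** The distance in the cycle graph on the places of [c]. *)
Definition cdist i j : nat :=
  let m := (i - j) + (j - i) in minn m (size c - m).

Lemma pos_lt x : pos x < size c. Proof. by rewrite index_mem gate_mem. Qed.

Lemma nth_pos x0 x : nth x0 c (pos x) = gate x.
Proof. by rewrite nth_index ?gate_mem. Qed.

Lemma pos_nth x0 i : i < size c -> pos (nth x0 c i) = i.
Proof. by move=> li; rewrite /pos gate_id ?mem_nth // index_uniq. Qed.

Lemma eq_pos x y : (pos x == pos y) = (gate x == gate y).
Proof.
apply/eqP/eqP => [pxy|]; last by rewrite /pos => ->.
by rewrite -(nth_pos x x) pxy nth_pos.
Qed.

Lemma pos_next x :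
  x \in c -> pos (next c x) = if (pos x).+1 < size c then (pos x).+1 else 0.
Proof.
move=> xc; rewrite /pos !gate_id ?mem_next // next_nth xc.
case: c xc Uc => [//|y q] _ Uyq; set i := index x (y :: q).
change (nth y q i) with (nth y (y :: q) i.+1).
case: ltnP => li; first exact: index_uniq.
by rewrite nth_default //= eqxx.
Qed.

Lemma cdist_edge x y k :
  e x y -> k < size c -> cdist (pos x) k <= cdist (pos y) k + (gate x != gate y).
Proof.
move=> exy lk; have [gxy|xy] := eqVneq; first by rewrite /pos gxy addn0.
have [/eqP|] := edge_gate exy; first by rewrite (negPf xy).
case/imsetP=> z zc Exy.
have lz := pos_lt z; have := pos_next zc; move: szc lk.
have [[-> ->]|[-> ->]] : x = z /\ y = next c z \/ x = next c z /\ y = z.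
  have: x \in [set z; next c z] by rewrite -Exy set21.
  have: y \in [set z; next c z] by rewrite -Exy set22.
  rewrite !inE => /orP[]/eqP yz /orP[]/eqP xz; rewrite ?yz ?xz; auto.
    by rewrite yz xz eirr in exy.
  by rewrite yz xz eirr in exy.
by case: ifP; rewrite /cdist /=; clear -lz; lia.
by case: ifP; rewrite /cdist /=; clear -lz; lia.
Qed.

Lemma dist_cycle_le x y :
  x \in c -> y \in c -> d x y <= cdist (pos x) (pos y).
Proof.
wlog le_xy : x y / pos x <= pos y => [wl xc yc|xc yc].
  have [|/ltnW] := leqP (pos x) (pos y) => lxy; first exact: wl.
  rewrite dist_sym; apply: leq_trans (wl _ _ lxy yc xc) _.
  by rewrite /cdist addnC.
have lx := pos_lt x; have ly := pos_lt y.
have [x0 [q Dc]] : exists x0 q, c = x0 :: q.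
  by case: (c) xc => // x0 q _; exists x0, q.
have nth_p z : z \in c -> z = nth x0 (x0 :: q) (pos z).
  by move=> zc; rewrite -Dc nth_pos gate_id.
have [Pq Eq] : path e x0 q /\ e (last x0 q) x0.
  by have /and3P[_] := Cc; rewrite Dc /= rcons_path => /andP[].
have szq : size c = (size q).+1 by rewrite Dc.
rewrite /cdist leq_min; apply/andP; split.
  rewrite {1}(nth_p x xc) {1}(nth_p y yc).
  apply: leq_trans (dist_nth Pq _) _; first by rewrite le_xy -ltnS -szq.
  by apply: leq_addl.
have d0 := @dist_nth x0 q 0 (pos x) Pq.
have d1 := @dist_nth x0 q (pos y) (size q) Pq.
have := dist_triangle x x0 y; have := dist_triangle x0 (last x0 q) y.
have := dist_edge Eq.
rewrite (dist_sym x x0) (dist_sym (last x0 q) x0) (dist_sym (last x0 q) y).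
move: d0 d1; rewrite [nth _ _ 0]/= (nth_last x0 (x0 :: q)) -!nth_p //=.
by rewrite leqnn andbT; clear -lx ly le_xy szq; lia.
Qed.

(** Along a path each edge either keeps the gate or moves it by one place round
   [c], in which case it is an edge of [c] and both of its ends are their own
   gates. *)
Lemma path_gate_size x p (z := last x p) :
  path e x p -> gate x != gate z ->
  d x (gate x) + cdist (pos x) (pos z) + d (gate z) z <= size p.
Proof.
rewrite {}/z; elim: p x => [|y p IHp] x /=; first by rewrite eqxx.
case/andP=> exy ep nxz; set z := last y p in nxz *.
have := cdist_edge exy (pos_lt z).
have [gxy | xy] := eqVneq (gate x) (gate y).
  have := IHp y ep; rewrite -gxy /pos -gxy -/z => /(_ nxz).
  have := dist_triangle x y (gate x); have := dist_edge exy; clear; lia.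
have [/eqP|/[dup] xc] := edge_gate exy; first by rewrite (negPf xy).
rewrite setUC => /cycle_edge_mem yc; move/cycle_edge_mem in xc.
rewrite addn1 gate_id // distxx add0n.
have [yz | yz] := eqVneq (gate y) (gate z); last first.
  by have := IHp y ep yz; rewrite gate_id // distxx -/z; clear; lia.
have := dist_le_path ep; rewrite -/z -yz gate_id // (_ : pos y = pos z).
  by rewrite /cdist; clear; lia.
by rewrite /pos yz.
Qed.

Lemma dist_gate x z :
  gate x != gate z ->
  d x z = d x (gate x) + cdist (pos x) (pos z) + d (gate z) z.
Proof.
move=> nxz; have [p [ep lp sp]] := dist_path x z.
apply/eqP; rewrite eqn_leq; apply/andP; split; last first.
  by have := path_gate_size ep; rewrite lp sp; apply.
have pg y : pos (gate y) = pos y by rewrite /pos (gate_id (gate_mem y)).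
have := dist_triangle x (gate x) z; have := dist_triangle (gate x) (gate z) z.
have := dist_cycle_le (gate_mem x) (gate_mem z); rewrite !pg; clear; lia.
Qed.

Lemma dist_to_cycle x z :
  z \in c -> d x z = d x (gate x) + cdist (pos x) (pos z).
Proof.
move=> zc; have [gxz|nxz] := eqVneq (gate x) (gate z).
  by rewrite /pos -gxz gxz gate_id // /cdist subnn min0n addn0.
by rewrite (dist_gate nxz) [in d (gate z)]gate_id // distxx addn0.
Qed.

End Gate.

(** ** Betweenness seen from a cycle *)

Lemma cdistC c i j : cdist c i j = cdist c j i.
Proof. by rewrite /cdist addnC. Qed.

Lemma cdist_short c i j :
  i <= j -> (j - i).*2 <= size c -> cdist c i j = j - i.
Proof. by rewrite /cdist => /eqP-> sh; apply/minn_idPl; lia. Qed.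

Lemma cdist_long c i j :
  i <= j -> size c <= (j - i).*2 -> cdist c i j = size c - (j - i).
Proof. by rewrite /cdist => /eqP-> lg; apply/minn_idPr; lia. Qed.

Lemma between_cdist c x y z (Cc : is_cycle e c) :
  y \in c -> between x y z ->
  cdist c (pos c x) (pos c y) + cdist c (pos c y) (pos c z)
    <= cdist c (pos c x) (pos c z).
Proof.
move=> yc; rewrite /between (dist_sym y z) !(dist_to_cycle Cc _ yc) => /eqP.
rewrite (cdistC c (pos c z)).
have [gxz|nxz] := eqVneq (gate c x) (gate c z).
  have := dist_triangle x (gate c x) z.
  by rewrite [d (gate c x) z]dist_sym gxz; clear; lia.
by rewrite (dist_gate Cc nxz) (dist_sym z); clear; lia.
Qed.

Lemma cdist_between c x y z (Cc : is_cycle e c) :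
  y \in c -> gate c x != gate c z ->
  cdist c (pos c x) (pos c y) + cdist c (pos c y) (pos c z)
    = cdist c (pos c x) (pos c z) -> between x y z.
Proof.
move=> yc nxz; rewrite /between (dist_gate Cc nxz) (dist_sym y z).
rewrite !(dist_to_cycle Cc _ yc) (dist_sym z) (cdistC c (pos c z)) => <-.
by apply/eqP; clear; lia.
Qed.

(** Both geodesics from [y] start with the only edge at [y]. *)
Lemma leaf_not_between x y z :
  degree e y = 1 -> x != y -> z != y -> ~~ between x y z.
Proof.
move=> /eqP/cards1P[w Nw] xy zy.
have nbr v : e y v -> v = w.
  by move=> eyv; apply/set1P; rewrite -Nw inE.
have [a /nbr-> da] : exists2 a, e y a & d y x = (d a x).+1.
  by apply: dist_step; rewrite eq_sym.
have [b /nbr-> db] : exists2 a, e y a & d y z = (d a z).+1.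
  by apply: dist_step; rewrite eq_sym.
rewrite /between (dist_sym x y) da db neq_ltn; apply/orP; right.
have := dist_triangle x w z; rewrite (dist_sym x w); clear; lia.
Qed.

Lemma degree_on_cycle c x : is_cycle e c -> x \in c -> 1 < degree e x.
Proof.
move=> Cc xc; have [i s rc] := rot_to xc.
have := Cc; rewrite -(is_cycle_rot i) rc => /and3P[].
case: s {rc} => [|a [|b s]] // _; rewrite [cycle _ _]/= rcons_path.
case/and4P=> exa _ _ elx /and3P[_ ab _].
apply/card_gt1P; exists a, (last b s); rewrite !inE exa esym elx; split=> //.
by apply: contraNneq ab => ->; apply: mem_last.
Qed.

(** If [y] is on two cycles, its neighbours on the second have [y] as their gate
   on the first, which makes [y] a cut vertex. *)
Lemma noncut_cycle_unique c1 c2 y :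
    is_cycle e c1 -> is_cycle e c2 -> y \in c1 -> y \in c2 ->
    ~~ cut_vertex e y ->
  cycle_edges c1 = cycle_edges c2.
Proof.
move=> C1 C2 y1 y2 Ncy; apply/eqP; apply: contraNT Ncy => nC.
have disj : [disjoint cycle_edges c1 & cycle_edges c2].
  by apply: edges_disj => //; apply/cyclesP; [exists c1 | exists c2].
have E2 : [set y; next c2 y] \in cycle_edges c2 by apply/imsetP; exists y.
have /and3P[_ cyc2 _] := C2.
have eyn : e y (next c2 y) by apply: next_cycle.
have gn : gate c1 (next c2 y) = y.
  rewrite -(gate_off C1 (x := y)) ?gate_id //; apply: connect1.
  by rewrite /off eyn (disjointFl disj E2).
rewrite -{1}gn; apply: (cut_on_cycle C1); rewrite gn.
by apply: contraTneq eyn => <-; rewrite eirr.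
Qed.

(** ** Counting non-cut vertices *)

Definition leaves : {set V} := [set x | degree e x == 1].

Lemma degree_gt0 x : 1 < #|V| -> 0 < degree e x.
Proof.
case/card_gt1P=> a [b [_ _ nab]].
have [y nxy] : exists y, x != y.
  by have [->|] := eqVneq x a; [exists b | exists a].
by have [z exz _] := dist_step nxy; apply/card_gt0P; exists z; rewrite inE.
Qed.

(** The alternatives, leaf, on one cycle, on several, are put into a single sum
   because it is summed over a set of vertices next. *)
Lemma noncut_place x :
  1 < #|V| -> ~~ cut_vertex e x ->
  (x \in leaves) + \sum_(C in cycles e) (x \in cover C) = 1.
Proof.
move=> V1 Ncx; rewrite inE.
have [dx|dx] := eqVneq.
  rewrite big1 // => C /cyclesP[c Cc ->]; rewrite cover_cycle_edges inE.
  by case: (boolP (x \in c)) => // /(degree_on_cycle Cc); rewrite dx.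
have [|c Cc xc] := noncut_on_cycle Ncx.
  by move: (degree_gt0 x V1) dx; case: (degree e x) => [|[]].
have CC : cycle_edges c \in cycles e by apply/cyclesP; exists c.
rewrite (bigD1 (cycle_edges c)) //= cover_cycle_edges inE xc.
rewrite big1 // => C /andP[/cyclesP[c' Cc' ->] nC].
rewrite cover_cycle_edges inE; case: (boolP (x \in c')) => // xc'.
by rewrite (noncut_cycle_unique Cc Cc' xc xc' Ncx) eqxx in nC.
Qed.

Lemma card_noncut R :
  1 < #|V| -> (forall x, x \in R -> ~~ cut_vertex e x) ->
  #|R| = #|R :&: leaves| + \sum_(C in cycles e) #|R :&: cover C|.
Proof.
move=> V1 NR.
have cardI (A : {set V}) : #|R :&: A| = \sum_(x in R) (x \in A).
  rewrite -sum1_card -big_mkcondr /=; apply: eq_bigl => x.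
  by rewrite inE.
rewrite cardI (eq_bigr _ (fun C _ => cardI (cover C))) exchange_big /=.
by rewrite -big_split /= -sum1_card; apply: eq_bigr => x /NR/noncut_place->.
Qed.

Lemma edgesP E :
  reflect (exists x y, e x y /\ E = [set x; y]) (E \in edges e).
Proof.
apply: (iffP imset2P) => [[x y _] | [x [y [exy ->]]]].
  by rewrite inE => exy ->; exists x, y.
by exists x y; rewrite ?inE.
Qed.

(** With more than two vertices no edge joins two leaves, so a pendant edge has
   exactly one of them. *)
Lemma card_leaves : 2 < #|V| -> #|leaves| = #|pendant_edges e|.
Proof.
move=> V2.
pose f x := x |: [set y | e x y].
have leafP x : x \in leaves -> exists y, [set y | e x y] = [set y].
  by rewrite inE => /cards1P.
have nbr x y : x \in leaves -> e x y -> f x = [set x; y].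
  move=> /leafP[w Nw] exy; rewrite /f Nw; suff -> : y = w by [].
  by apply/set1P; rewrite -Nw inE.
have -> : pendant_edges e = f @: leaves.
  apply/setP=> E; rewrite inE; apply/andP/imsetP => [[]|[x xL ->]].
    case/edgesP=> x [y [exy ->]] /exists_inP[z].
    rewrite !inE => /orP[]/eqP-> dz; [exists x | exists y]; rewrite ?inE //.
      by rewrite (nbr x y) ?inE.
    by rewrite (nbr y x) ?inE // 1?esym // setUC.
  have [y Ny] := leafP x xL; have exy : e x y by have := set11 y; rewrite -Ny inE.
  rewrite (nbr x y) //; split; first by apply/edgesP; exists x, y.
  by apply/exists_inP; exists x; rewrite ?set21 //; move: xL; rewrite inE.
rewrite card_in_imset // => x y xL yL fxy.
apply/eqP; apply: contraLR V2 => nxy; rewrite -leqNgt.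
have [a Na] := leafP x xL; have [b Nb] := leafP y yL.
have ya : y = a.
  have: y \in f x by rewrite fxy setU11.
  by rewrite /f Na !inE eq_sym (negPf nxy) => /eqP.
have xb : x = b.
  have: x \in f y by rewrite -fxy setU11.
  by rewrite /f Nb !inE (negPf nxy) => /eqP.
have clxy : closed e [set x; y].
  apply: (intro_closed (sym_connect_sym esym)) => u v euv.
  have vN : v \in [set w | e u w] by rewrite inE.
  rewrite !inE => /orP[]/eqP uE; move: vN; rewrite uE ?Na ?Nb !inE.
    by rewrite ya => ->; rewrite orbT.
  by rewrite xb => ->.
rewrite -cardsT (_ : setT = [set x; y]) ?cards2 ?nxy //.
apply/setP=> v; rewrite !inE /=.
have := closed_connect clxy (connected_connect x v).
by rewrite !inE eqxx.
Qed.

(** ** Good cycles *)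

Lemma bigmin_leP (T : eqType) (s : seq T) (P : pred T) (F : T -> nat) n m :
  m < n ->
  reflect (exists j, [/\ j \in s, P j & F j <= m])
          (\big[minn/n]_(j <- s | P j) F j <= m).
Proof.
move=> mn; elim: s => [|a s IHs].
  by rewrite big_nil leqNgt mn; constructor=> -[j []].
rewrite big_cons; case: ifP => [Pa|nPa]; last first.
  apply: (iffP IHs) => [] [j [js Pj Fj]]; exists j; rewrite ?inE ?js ?orbT //.
  move: js; rewrite inE => /orP[/eqP ja|]; first by rewrite -ja Pj in nPa.
  by [].
rewrite geq_min; apply: (iffP orP) => [[Fa|/IHs[j [js Pj Fj]]]|[j [js Pj Fj]]].
- by exists a; rewrite mem_head.
- by exists j; rewrite inE js orbT.
move: js; rewrite inE => /orP[/eqP<-|js]; first by left.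
by right; apply/IHs; exists j.
Qed.

Lemma Dc_leP c m : m < size c ->
  reflect (exists x y, cut_path e c x y /\ size (arc c x y) <= m)
          (Dc e c <= m).
Proof.
move=> mc; rewrite /Dc.
apply: (iffP (bigmin_leP _ _ _ mc)) => [[x [_ xc /bigmin_leP]]|[x [y [cxy sxy]]]].
  by case/(_ mc)=> y [_ /andP[_ cxy] sxy]; exists x, y.
have /and4P[xc yc _ _] := cxy.
exists x; split; rewrite ?mem_index_enum //.
by apply/bigmin_leP => //; exists y; rewrite mem_index_enum yc.
Qed.

Lemma good_cycle_rot i c : is_cycle e c -> good_cycle e (rot i c) -> good_cycle e c.
Proof.
move=> Cc; have /and3P[szc _ Uc] := Cc.
have Dc_rot m : m < size c -> Dc e (rot i c) <= m -> Dc e c <= m.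
  move=> mc /Dc_leP; rewrite size_rot => /(_ mc)[x [y [/and4P[]]]].
  rewrite !mem_rot => xc yc nxy /allP cuts; rewrite arc_rot // => sxy.
  apply/Dc_leP => //; exists x, y; split=> //; rewrite /cut_path xc yc nxy.
  by apply/allP=> z zc; have := cuts z; rewrite mem_rot arc_rot // => /(_ zc).
rewrite /good_cycle /end_block size_rot (permP (permEl (perm_rot i c))).
case/orP=> [-> //|G]; apply/orP; right; move: G.
by case: ifP => _; apply: Dc_rot; move: szc; clear; lia.
Qed.

(** Both parity cases of goodness bound [D_c] by the largest [m] with
   [2 m + 3 <= size c], and [m = 0] makes the same condition describe an
   end-block.  The last clause excludes [m = 0] for a cycle without cut
   vertices. *)
Lemma good_cycle_arc c :
  is_cycle e c -> good_cycle e c ->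
  exists i m, [/\ m.*2 + 3 <= size c,
                  {in c, forall z, cut_vertex e z -> index z (rot i c) <= m} &
                  m = 0 -> exists2 z, z \in c & cut_vertex e z].
Proof.
move=> Cc; have /and3P[szc _ Uc] := Cc.
case/orP=> [|G].
  move/eqP=> E1; have hc : has (cut_vertex e) c by rewrite has_count E1.
  have /hasP[x xc cx] := hc; have [i s rc] := rot_to xc.
  exists i, 0; split=> //; last by exists x.
  move=> z zc cz; move: E1; rewrite -(permP (permEl (perm_rot i c))) rc /= cx.
  case=> /eqP; rewrite -[_ == 0]negbK -lt0n -has_count => /hasPn no.
  have : z \in rot i c by rewrite mem_rot.
  rewrite rc inE => /orP[/eqP->|/no]; first by rewrite eqxx.
  by rewrite cz.
have [m mc Dm] : exists2 m, m.*2 + 3 <= size c & Dc e c <= m.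
  case: ifP G => sz G.
    by exists ((size c)./2 - 1) => //; move: szc sz; clear; lia.
  exists ((size c)./2 - 2) => //; move: szc sz; clear; lia.
have /Dc_leP[|x [y [/and4P[xc yc nxy /allP cuts] sxy]]] := Dm.
  by move: mc; clear; lia.
have [i p1 p2 arc1 _ rc] := rot_to_arc Uc xc yc nxy.
exists i, m; split=> // [z zc cz|m0]; last by move: sxy; rewrite -arc1 m0.
have := cuts z zc; rewrite cz -arc1 rc implyTb => zin.
have -> : x :: p1 ++ y :: p2 = rcons (x :: p1) y ++ p2 by rewrite cat_rcons.
rewrite index_cat zin; apply: leq_trans sxy.
by rewrite -arc1 -ltnS; move: zin; rewrite -index_mem size_rcons.
Qed.

Lemma size_arc c x y :
  x \in c -> y \in c -> index x c <= index y c -> uniq c ->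
  size (arc c x y) = index y c - index x c /\
  {in c, forall z, index x c <= index z c <= index y c ->
         z \in rcons (arc c x y) y}.
Proof.
move=> xc yc le_xy Uc; have lx := xc; rewrite -index_mem in lx.
have Idrop z : z \in c -> index x c <= index z c ->
    index z (rot (index x c) c) = index z c - index x c /\
    z \in drop (index x c) c.
  move=> zc lxz.
  have zd : z = nth z (drop (index x c) c) (index z c - index x c).
    by rewrite nth_drop subnKC // nth_index.
  have lz : index z c - index x c < size (drop (index x c) c).
    by rewrite size_drop ltn_sub2r // index_mem.
  have zin : z \in drop (index x c) c by rewrite zd mem_nth.
  by rewrite /rot index_cat zin {1}zd index_uniq // drop_uniq.
have [Iy _] := Idrop y yc le_xy.
rewrite /arc Iy; split.
  rewrite size_takel // size_rot.
  by apply: leq_trans (leq_subr _ _) _; apply: index_size.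
move=> z zc /andP[lxz]; rewrite leq_eqVlt mem_rcons inE => /orP[/eqP Izy|lzy].
  by rewrite -(nth_index z zc) Izy nth_index // eqxx.
have [Iz zd] := Idrop z zc lxz; apply/orP; right.
rewrite in_take ?mem_rot // Iz; move: lxz lzy le_xy; clear; lia.
Qed.

Lemma good_of_arc c x y :
    is_cycle e c -> x \in c -> y \in c -> cut_vertex e x ->
    {in c, forall z, cut_vertex e z -> index x c <= index z c <= index y c} ->
    (index y c - index x c).*2 + 3 <= size c ->
  good_cycle e c.
Proof.
move=> Cc xc yc cx cuts lc; have /and3P[szc _ Uc] := Cc.
have [xy|nxy] := eqVneq x y.
  apply/orP; left; rewrite /end_block.
  rewrite (eq_in_count (a2 := pred1 x)) ?count_uniq_mem ?xc // => z zc /=.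
  apply/idP/eqP => [cz|->//]; have := cuts z zc cz.
  rewrite -xy -eqn_leq => /eqP E.
  by rewrite -(nth_index x zc) -E nth_index.
have /andP[_ le_xy] := cuts x xc cx.
have [sxy arc_xy] := size_arc xc yc le_xy Uc.
have Dm : Dc e c <= index y c - index x c.
  apply/Dc_leP; first by move: lc; clear; lia.
  exists x, y; rewrite sxy; split=> //; apply/and4P; split=> //.
  by apply/allP=> z zc; apply/implyP=> cz; apply: arc_xy => //; apply: cuts.
by apply/orP; right; case: ifP => sz; move: Dm lc sz; clear; lia.
Qed.

(** ** The two free places of a good cycle *)

(** The last condition lets the vertices of [P] belong to a general position
   set whose other vertices all lie outside [C]. *)
Definition free_pair (C : {set {set V}}) (P : {set V}) : Prop :=
  [/\ #|P| = 2, P \subset cover C, {in P, forall y, ~~ cut_vertex e y} &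
      forall x y z, y \in P -> x != y -> y != z -> x != z ->
        (x \in cover C -> x \in P) -> (z \in cover C -> z \in P) ->
        ~~ between x y z].

(** The pair consists of the two neighbours of the arc that carries the cut
   vertices.  They are equally far from its ends, and the way between them
   outside the arc is longer than the arc; so going round through one of them
   is a detour. *)
Lemma good_free_pair c :
  is_cycle e c -> good_cycle e c -> exists P, free_pair (cycle_edges c) P.
Proof.
move=> Cc0 /(good_cycle_arc Cc0)[i [m [lm0 cuts0 _]]].
have U0 : uniq c by case/and3P: Cc0.
rewrite -(cycle_edges_rot i U0).
have Cc : is_cycle e (rot i c) by rewrite is_cycle_rot.
have lm : m.*2 + 3 <= size (rot i c) by rewrite size_rot.
have cuts z : z \in rot i c -> cut_vertex e z -> index z (rot i c) <= m.
  by rewrite mem_rot => /cuts0.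
move: (rot i c) Cc lm cuts => {c Cc0 i lm0 cuts0 U0} c Cc lm cuts.
have /and3P[szc _ Uc] := Cc.
have [x0 x0c] : exists x0, x0 \in c.
  by case: (c) szc => // x0 q _; exists x0; apply: mem_head.
pose a := nth x0 c m.+1; pose b := nth x0 c (size c).-1.
have la : m.+1 < size c by move: lm; clear; lia.
have lb : (size c).-1 < size c by move: szc; clear; lia.
have pa : pos c a = m.+1 by apply: pos_nth.
have pb : pos c b = (size c).-1 by apply: pos_nth.
have ac : a \in c by apply: mem_nth.
have bc : b \in c by apply: mem_nth.
have inP x : x \in [set a; b] -> x \in c /\ m < pos c x.
  rewrite !inE => /orP[]/eqP->; rewrite ?pa ?pb; split=> //.
  by move: lm; clear; lia.
exists [set a; b]; split.
- rewrite cards2; suff -> : a != b by [].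
  by apply/eqP => ab; move: pb lm; rewrite -ab pa; clear; lia.
- by apply/subsetP=> x /inP[xc _]; rewrite cover_cycle_edges inE.
- move=> y /inP[yc py]; apply/negP => /(cuts y yc); rewrite leqNgt.
  by move: py; rewrite /pos gate_id // => ->.
move=> x y z yP xy yz xz; rewrite cover_cycle_edges !inE => xP zP.
apply/negP => B; have [yc _] := inP y yP.
have {}yP : pos c y = m.+1 \/ pos c y = (size c).-1.
  by move: yP; rewrite !inE => /orP[]/eqP->; rewrite ?pa ?pb; auto.
have place w : w != y -> (w \in c -> (w == a) || (w == b)) ->
    pos c w != pos c y /\
    (pos c w <= m \/ pos c w = m.+1 \/ pos c w = (size c).-1).
  move=> wy wP; have [wc|wc] := boolP (w \in c).
    split; last by case/orP: (wP wc) => /eqP->; rewrite ?pa ?pb; auto.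
    by rewrite eq_pos // !gate_id.
  have lwm : pos c w <= m.
    apply: cuts; rewrite ?gate_mem //; apply: cut_on_cycle => //.
    by rewrite gate_eq_mem.
  split; last by left.
  by case: yP => ->; move: lwm lm; clear; lia.
have zy : z != y by rewrite eq_sym.
have [nxy px] := place x xy xP; have [nzy pz] := place z zy zP.
have := between_cdist Cc yc B; rewrite /cdist.
move: (pos c x) (pos c y) (pos c z) (size c) yP px pz nxy nzy lm.
clear=> px py pz l; case=> -> [lx|[]->] [lz|[]->]; lia.
Qed.

(** * General position sets of non-cut vertices *)

Lemma gp_attained : exists2 R, general_position e R & #|R| = gp e.
Proof.
have gp0 : general_position e set0.
  by apply/general_positionP => x y z; rewrite inE.
have [|R gR maxR] := @eq_bigmax_cond _ (general_position e) (fun R => #|R|).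
  by apply/card_gt0P; exists set0.
by exists R; rewrite // -maxR; apply: eq_bigl.
Qed.

Lemma card_le_gp R : general_position e R -> #|R| <= gp e.
Proof. exact: (@leq_bigmax_cond _ (general_position e) (fun R => #|R|) R). Qed.

(** Suppose that three vertices of [R] lie on [c], and go round [c] from the
   gate of a fourth vertex of [R].  Of the three, let [v] be met second: a
   geodesic from the fourth vertex to [v] passes through the first or the last
   of them. *)
Lemma general_position_cycle R c :
  general_position e R -> is_cycle e c -> 3 < #|R| ->
  #|R :&: [set x in c]| <= 2.
Proof.
move=> /general_positionP gpR Cc0 R4; rewrite leqNgt; apply/negP.
case/card_gt2P=> x [y [z [[xc yc zc] [nxy nyz nzx]]]].
have [w wR [nwx nwy nwz]] : exists2 w, w \in R & [/\ w != x, w != y & w != z].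
  have [w] : exists w, w \in R :\: [set x; y; z].
    apply/set0Pn; rewrite -card_gt0 cardsD subn_gt0.
    apply: leq_ltn_trans R4; apply: leq_trans (subset_leq_card (subsetIr _ _)) _.
    apply: leq_trans (leq_card_setU _ _) _.
    by rewrite cards1 cards2; case: (_ != _).
  by rewrite !inE !negb_or => /andP[/andP[/andP[nx ny] nz] wR]; exists w.
have [i s rc] := rot_to (gate_mem Cc0 w).
(* The gate of w is moved to place 0. *)
pose c1 := rot i c; have Cc : is_cycle e c1 by rewrite is_cycle_rot.
have inc u : u \in R :&: [set x in c] -> u \in R /\ u \in c1.
  by rewrite !inE mem_rot => /andP[].
have {xc}[xR xc] := inc x xc; have {yc}[yR yc] := inc y yc.
have {zc inc}[zR zc] := inc z zc.
have pw : pos c1 w = 0.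
  have gw : gate c1 w = gate c w.
    apply: gate_unique => //; first by rewrite mem_rot gate_mem.
    rewrite /off /c1 cycle_edges_rot; first exact: gate_connect.
    by case/and3P: Cc0.
  by rewrite /pos gw /c1 rc /= eqxx.
have neq u v : u \in c1 -> v \in c1 -> u != v -> pos c1 u != pos c1 v.
  by move=> uc vc nuv; rewrite eq_pos // !gate_id.
have B u v : u \in R -> v \in R -> u \in c1 -> v \in c1 -> u != v ->
    w != u -> w != v -> pos c1 v != 0 ->
    cdist c1 0 (pos c1 u) + cdist c1 (pos c1 u) (pos c1 v) !=
    cdist c1 0 (pos c1 v).
  move=> uR vR uc vc nuv nwu nwv v0; apply/eqP => E.
  have := gpR w u v wR uR vR nwu nuv nwv; rewrite (cdist_between Cc) //.
    by rewrite -eq_pos // pw eq_sym.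
  by rewrite pw.
have mid u v t : [/\ u \in R, u \in c1 & w != u] ->
    [/\ v \in R, v \in c1 & w != v] -> [/\ t \in R, t \in c1 & w != t] ->
    pos c1 u < pos c1 v -> pos c1 v < pos c1 t -> False.
  move=> [uR uc nwu] [vR vc nwv] [tR tc nwt] luv lvt.
  have v0 : pos c1 v != 0 by rewrite -lt0n (leq_ltn_trans _ luv).
  have nuv : u != v by apply: contraTneq luv => ->; rewrite ltnn.
  have ntv : t != v by apply: contraTneq lvt => ->; rewrite ltnn.
  have := B u v uR vR uc vc nuv nwu nwv v0.
  have := B t v tR vR tc vc ntv nwt nwv v0.
  have lt := pos_lt Cc t; have [short|long] := leqP (pos c1 v).*2 (size c1).
    move=> _ /eqP[]; rewrite !cdist_short ?subn0 //; move: luv short; clear; lia.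
  move=> /eqP[]; rewrite (cdistC _ (pos c1 t)).
  rewrite (@cdist_short _ (pos c1 v)) ?(@cdist_long _ 0) //;
    move: lt luv lvt long; clear; lia.
have Sx := And3 xR xc nwx; have Sy := And3 yR yc nwy.
have Sz := And3 zR zc nwz.
have := neq z x zc xc nzx; have := neq y z yc zc nyz.
have := neq x y xc yc nxy.
case: (ltngtP (pos c1 x) (pos c1 y)) => // xy _;
case: (ltngtP (pos c1 y) (pos c1 z)) => // yz _;
case: (ltngtP (pos c1 z) (pos c1 x)) => // zx _.
all: first
  [ by apply: (mid _ _ _ _ _ _ xy yz) | by apply: (mid _ _ _ _ _ _ yz xy)
  | by apply: (mid _ _ _ _ _ _ yz zx) | by apply: (mid _ _ _ _ _ _ zx yz)
  | by apply: (mid _ _ _ _ _ _ zx xy) | by apply: (mid _ _ _ _ _ _ xy zx)].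
Qed.

(** The branch at [z] can be left only through [z]. *)
Lemma branch_noncut c z :
  is_cycle e c -> z \in c -> cut_vertex e z ->
  exists v, [/\ gate c v = z, v != z & ~~ cut_vertex e v].
Proof.
move=> Cc zc cz; have [y gy yz] := cut_gate Cc cz zc.
have [|||v] := @exists_noncut z [set x | (gate c x == z) && (x != z)].
- by apply/set0Pn; exists y; rewrite inE gy eqxx.
- by rewrite !inE eqxx andbF.
- move=> a b; rewrite !inE => /andP[/eqP ga az] eab bz.
  have [<-|] := edge_gate Cc eab; first by rewrite ga eqxx.
  by move/cycle_edge_mem=> ac; rewrite -ga gate_id ?eqxx in az.
by rewrite inE => /andP[/eqP gv vz] Ncv; exists v.
Qed.

(** The cycles [c] and [c2] differ, so that no edge of [c2] is an edge of [c]. *)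
Lemma gate_cycle c c2 x y :
  is_cycle e c -> is_cycle e c2 -> x \in c2 -> y \in c2 -> x \notin c ->
  gate c x = gate c y.
Proof.
move=> C1 C2 x2 y2 xc; apply: (gate_off C1).
have nC : cycle_edges c != cycle_edges c2.
  apply: contraNneq xc => E; have : x \in cover (cycle_edges c2).
    by rewrite cover_cycle_edges inE.
  by rewrite -E cover_cycle_edges inE.
have disj : [disjoint cycle_edges c & cycle_edges c2].
  by apply: edges_disj => //; apply/cyclesP; [exists c | exists c2].
have /and3P[_ cyc2 U2] := C2.
have: fconnect (next c2) x y by rewrite (fconnect_cycle (cycle_next U2)).
apply: connect_sub => a b /eqP<-; have [a2|a2] := boolP (a \in c2).
  apply: connect1; rewrite /off next_cycle // (disjointFl disj) //.
  by apply/imsetP; exists a.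
by rewrite next_nth (negPf a2) connect0.
Qed.

(** A non-cut vertex of the branch at [z] is a leaf or lies on a cycle, and this
   cycle stays in the branch. *)
Lemma branch_meets R c z :
    1 < #|V| -> leaves \subset R ->
    (forall C, C \in cycles e -> R :&: cover C != set0) ->
    (forall x, x \in R -> ~~ cut_vertex e x) ->
    is_cycle e c -> z \in c -> cut_vertex e z ->
  exists2 r, r \in R & gate c r = z /\ r \notin c.
Proof.
move=> V1 LR CR NR Cc zc cz.
have [v [gv vz Ncv]] := branch_noncut Cc zc cz.
have vc : v \notin c by rewrite -(gate_eq_mem Cc) gv eq_sym.
have [lv|dv] := eqVneq (degree e v) 1.
  by exists v => //; apply: (subsetP LR); rewrite inE lv.
have [|c2 C2 v2] := noncut_on_cycle Ncv.
  by move: (degree_gt0 v V1) dv; case: (degree e v) => [|[]].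
have /set0Pn[r] : R :&: cover (cycle_edges c2) != set0.
  by apply: CR; apply/cyclesP; exists c2.
rewrite cover_cycle_edges !inE => /andP[rR r2].
have gr : gate c r = z by rewrite -(gate_cycle Cc C2 v2 r2 vc).
exists r => //; split=> //; rewrite -(gate_eq_mem Cc) gr.
by apply: contraTneq cz => ->; apply: NR.
Qed.

(** The free vertices [a] and [b] of [c] leave all cut vertices on one of the
   two arcs between them, for a geodesic joining branches on different arcs
   would pass through [a] or [b].  Let [x] and [y] be the first and the last
   cut vertex on the way from [a] to [b] along that arc: from [x] to [b] this
   way takes less than half of [c], or else a geodesic from the branch at [x]
   to [b] would pass through [a]; and [y] comes before [b]. *)
Lemma good_of_general_position R a b s1 s2 z0 (c := a :: s1 ++ b :: s2) :
    general_position e R -> is_cycle e c -> a \in R -> b \in R ->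
    ~~ cut_vertex e a -> ~~ cut_vertex e b ->
    {in c, forall z, cut_vertex e z ->
      exists2 r, r \in R & gate c r = z /\ r \notin c} ->
    z0 \in s1 -> cut_vertex e z0 ->
  good_cycle e c.
Proof.
move=> /general_positionP gpR Cc aR bR Nca Ncb branch z0s cz0.
have /and3P[_ _ Uc] := Cc.
have ac : a \in c by apply: mem_head.
have bc : b \in c by rewrite /c -cat_cons mem_cat mem_head orbT.
pose m := (size s1).+1; pose l := size c.
have lc : m < l by rewrite /l /c /= size_cat /=; clear; lia.
have pa : pos c a = 0 by rewrite /pos gate_id //= eqxx.
have pb : pos c b = m.
  have -> : b = nth a c m by rewrite /c /m -cat_cons nth_cat ltnn subnn.
  exact: pos_nth.
have z0c : z0 \in c by rewrite inE mem_cat z0s orbT.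
have pc z : z \in c -> pos c z = index z c by move=> zc; rewrite /pos gate_id.
have lz0 : index z0 c < m.
  rewrite /c -cat_cons index_cat inE z0s orbT -[m]/(size (a :: s1)).
  by rewrite index_mem inE z0s orbT.
have cut_neq z : z \in c -> cut_vertex e z -> index z c != 0 /\ index z c != m.
  move=> zc cz; rewrite -pc // -{1}pa -pb !eq_pos // !gate_id //.
  by split; apply: contraTneq cz => ->.
have Bbr z z' y : z \in c -> z' \in c -> cut_vertex e z -> cut_vertex e z' ->
    z != z' -> y \in R -> y \in c ->
    cdist c (index z c) (pos c y) + cdist c (pos c y) (index z' c) !=
    cdist c (index z c) (index z' c).
  move=> zc zc' cz cz' nzz' yR yc; apply/eqP => E.
  have [r rR [gr nr]] := branch z zc cz.
  have [r' rR' [gr' nr']] := branch z' zc' cz'.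
  have nyr : r != y by apply: contraNneq nr => ->.
  have nyr' : y != r' by apply: contraNneq nr' => <-.
  have nrr : gate c r != gate c r' by rewrite gr gr'.
  have nrr' : r != r' by apply: contraNneq nrr => ->.
  have := gpR r y r' rR yR rR' nyr nyr' nrr'.
  by rewrite (cdist_between Cc) // /pos gr gr'.
have nab : a != b.
  by rewrite -(gate_id Cc ac) -(gate_id Cc bc) -eq_pos // pa pb.
have Bxab z : z \in c -> cut_vertex e z ->
    cdist c (index z c) (pos c a) + cdist c (pos c a) (pos c b) !=
    cdist c (index z c) (pos c b).
  move=> zc cz; apply/eqP => E.
  have [r rR [gr nr]] := branch z zc cz.
  have nra : r != a by apply: contraNneq nr => ->.
  have nrb : r != b by apply: contraNneq nr => ->.
  have nrr : gate c r != gate c b.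
    by rewrite gr gate_id //; apply: contraNneq Ncb => <-.
  have := gpR r a b rR aR bR nra nab nrb.
  by rewrite (cdist_between Cc) // /pos gr.
have cuts z : z \in c -> cut_vertex e z -> 0 < index z c < m.
  move=> zc cz; have [iz0 izm] := cut_neq z zc cz.
  have [i00 i0m] := cut_neq z0 z0c cz0.
  rewrite lt0n iz0 ltnNge; apply/negP => lz.
  have nz0 : z0 != z by apply: contraTneq lz => <-; rewrite -ltnNge.
  have lzl : index z c < l by rewrite index_mem.
  have lz0z : index z0 c <= index z c by apply: leq_trans lz; apply: ltnW.
  have [short|long] := leqP (index z c - index z0 c).*2 l.
    have /eqP[] := Bbr z0 z b z0c zc cz0 cz nz0 bR bc.
    rewrite pb !cdist_short //; move: lz lz0 short; rewrite /l; clear; lia.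
  have /eqP[] := Bbr z0 z a z0c zc cz0 cz nz0 aR ac.
  rewrite pa (cdistC c _ 0) (@cdist_short c 0) // ?(@cdist_long c) //;
    move: lzl lz0z long; rewrite /l; clear; lia.
pose Q := [pred z | (z \in c) && cut_vertex e z].
have Q0 : Q z0 by rewrite /= z0c.
case: (arg_minnP (fun z => index z c) Q0) => x /= /andP[xc cx] minx.
case: (arg_maxnP (fun z => index z c) Q0) => y /= /andP[yc cy] maxy.
apply: (good_of_arc Cc xc yc cx) => [z zc cz|].
  by apply/andP; split; [apply: minx | apply: maxy]; rewrite /= zc cz.
have /andP[x0 xm] := cuts x xc cx; have /andP[_ ym] := cuts y yc cy.
have short : (m - index x c).*2 < l.
  rewrite ltnNge; apply/negP => long.
  have /eqP[] := Bxab x xc cx.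
  rewrite pa pb (cdistC c _ 0) (@cdist_short c 0) // ?(@cdist_long c) //;
    move: lc xm long; rewrite /l; clear; lia.
by move: xm ym short; rewrite -/l; clear; lia.
Qed.

(** Only two of the vertices of [R] lie on [c]; the gate of a third one is a cut
   vertex on one of the two arcs between them. *)
Lemma good_of_full R c :
    general_position e R -> (forall x, x \in R -> ~~ cut_vertex e x) ->
    3 < #|R| -> leaves \subset R ->
    (forall C, C \in cycles e -> #|R :&: cover C| = 2) ->
  is_cycle e c -> good_cycle e c.
Proof.
move=> gpR NR R4 LR CR Cc; have /and3P[_ _ Uc] := Cc.
have V1 : 1 < #|V| by apply: leq_trans (max_card R); apply: ltnW; apply: ltnW.
have Rc : #|R :&: [set x in c]| = 2.
  by rewrite -cover_cycle_edges CR //; apply/cyclesP; exists c.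
have branch c' : is_cycle e c' -> {in c', forall z, cut_vertex e z ->
      exists2 r, r \in R & gate c' r = z /\ r \notin c'}.
  move=> Cc' z zc cz; apply: branch_meets => // C /CR E.
  by rewrite -card_gt0 E.
have [x xR xc] : exists2 x, x \in R & x \notin c.
  have /subsetPn[x xR] : ~~ (R \subset [set x in c]).
    apply: contraTN R4 => /setIidPl RI; rewrite -leqNgt -RI Rc //.
  by rewrite inE; exists x.
have gx := gate_mem Cc x.
have cgx : cut_vertex e (gate c x).
  by apply: (cut_on_cycle Cc); rewrite gate_eq_mem.
have /eqP/cards2P[a [b [nab RE]]] := Rc.
have [aR ac] : a \in R /\ a \in c.
  by apply/andP; have := set21 a b; rewrite -RE !inE.
have [bR bc] : b \in R /\ b \in c.
  by apply/andP; have := set22 a b; rewrite -RE !inE.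
have [i s1 s2 _ _ rc] := rot_to_arc Uc ac bc nab.
have Cci : is_cycle e (rot i c) by rewrite is_cycle_rot.
have [j rc'] : exists j, rot j (rot i c) = b :: s2 ++ a :: s1.
  by exists (size (a :: s1)); rewrite rc -cat_cons rot_size_cat.
have : gate c x \in rot i c by rewrite mem_rot.
rewrite rc -cat_cons mem_cat !in_cons.
have [ga|_] := eqVneq; first by rewrite ga (negPf (NR a aR)) in cgx.
have [gb|_] := eqVneq; first by rewrite gb (negPf (NR b bR)) in cgx.
move=> /= /orP[gs|gs]; apply: (good_cycle_rot Cc (i := i)).
  have Cab : is_cycle e (a :: s1 ++ b :: s2) by rewrite -rc.
  rewrite rc; apply: (good_of_general_position gpR Cab aR bR _ _ _ gs cgx);
    by [apply: NR | apply: branch].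
have Cba : is_cycle e (b :: s2 ++ a :: s1) by rewrite -rc' is_cycle_rot.
apply: (good_cycle_rot Cci (i := j)); rewrite rc'.
apply: (good_of_general_position gpR Cba bR aR _ _ _ gs cgx);
  by [apply: NR | apply: branch].
Qed.

(** A cut vertex is between any two vertices that it separates. *)
Lemma leaf_noncut y : y \in leaves -> ~~ cut_vertex e y.
Proof.
rewrite inE => /eqP dy; apply/cut_vertexPn => u v uy vy.
apply: contraTT isT => /(between_cut uy vy) B.
by rewrite (negPf (leaf_not_between dy uy vy)) in B.
Qed.

Lemma noncut_cover_unique C C' y :
    C \in cycles e -> C' \in cycles e -> y \in cover C -> y \in cover C' ->
  ~~ cut_vertex e y -> C = C'.
Proof.
move=> /cyclesP[c Cc ->] /cyclesP[c' Cc' ->].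
by rewrite !cover_cycle_edges !inE; apply: noncut_cycle_unique.
Qed.

Lemma leaf_not_cover C y : y \in leaves -> C \in cycles e -> y \notin cover C.
Proof.
rewrite inE => /eqP dy /cyclesP[c Cc ->]; rewrite cover_cycle_edges inE.
by apply/negP => /(degree_on_cycle Cc); rewrite dy.
Qed.

(** The set consists of all leaves and a free pair on each cycle.  It contains
   no cut vertex, so the vertices of the pair of [C] are its only ones on [C],
   as the definition of a free pair demands. *)
Lemma good_general_position :
    1 < #|V| -> (forall c, is_cycle e c -> good_cycle e c) ->
  exists2 R, general_position e R & #|R| = #|leaves| + 2 * #|cycles e|.
Proof.
move=> V1 good.
have [P HP] : exists P : {set {set V}} -> {set V},
    forall C, C \in cycles e -> free_pair C (P C).
  apply: (@fin_all_exists _ (fun=> {set V})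
    (fun C P => C \in cycles e -> free_pair C P)) => C.
  case: (boolP (C \in cycles e)) => [/cyclesP|_].
    by case=> c Cc ->; have [P HP] := good_free_pair Cc (good c Cc); exists P.
  by exists set0.
pose R := leaves :|: \bigcup_(C in cycles e) P C.
have NR x : x \in R -> ~~ cut_vertex e x.
  rewrite inE => /orP[/leaf_noncut //|/bigcupP[C CC xP]].
  by have [_ _ N _] := HP C CC; apply: N.
have Rcov C x : C \in cycles e -> x \in R -> x \in cover C -> x \in P C.
  move=> CC xR xC; have Ncx := NR x xR.
  move: xR; rewrite inE => /orP[/leaf_not_cover/(_ CC)|/bigcupP[C' CC' xP]].
    by rewrite xC.
  have [_ /subsetP sP _ _] := HP C' CC'.
  by rewrite (noncut_cover_unique CC CC' xC (sP x xP) Ncx).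
exists R.
  apply/general_positionP => x y z xR yR zR xy yz xz.
  have [yL|yP] := setUP yR.
    apply: leaf_not_between => //; last by rewrite eq_sym.
    by move: yL; rewrite inE => /eqP.
  have /bigcupP[C CC yPC] := yP; have [_ _ _ N] := HP C CC.
  by apply: N yPC xy yz xz _ _ => ?; apply: Rcov.
rewrite (card_noncut V1 NR) (setIidPr (subsetUl _ _)) mulnC -sum_nat_const.
congr (_ + _); apply: eq_bigr => C CC; have [P2 /subsetP sP _ _] := HP C CC.
rewrite -P2; congr #|pred_of_set _|; apply/setP=> x; rewrite inE.
apply/andP/idP => [[xR xC]|xP]; first exact: Rcov.
by split; [rewrite inE; apply/orP; right; apply/bigcupP; exists C | apply: sP].
Qed.

(** One vertex is counted for each leaf and at most two for each cycle. *)
Lemma gp_le : 2 < #|V| -> gp e <= maxn 3 (2 * #|cycles e| + #|pendant_edges e|).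
Proof.
move=> V2; have V1 := ltnW V2.
have [R0 gR0 <-] := gp_attained.
have [R [gR <- NR]] := general_position_noncut gR0.
rewrite leq_max; case: leqP => //= R4.
rewrite (card_noncut V1 NR) -(card_leaves V2) addnC leq_add //; last first.
  exact: subset_leq_card (subsetIr _ _).
rewrite mulnC -sum_nat_const; apply: leq_sum => C /cyclesP[c Cc ->].
by rewrite cover_cycle_edges general_position_cycle.
Qed.

(** Equality in the count of [gp_le] forces equality for the leaves and for each
   cycle. *)
Lemma good_of_gp c :
  3 < gp e -> gp e = 2 * #|cycles e| + #|pendant_edges e| ->
  is_cycle e c -> good_cycle e c.
Proof.
move=> gp4 gpE Cc; have [R0 gR0 cR0] := gp_attained.
have [R [gR cR NR]] := general_position_noncut gR0.
have R4 : 3 < #|R| by rewrite cR cR0.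
have V2 : 2 < #|V| by apply: leq_trans (max_card R); apply: ltnW.
have V1 := ltnW V2.
have le2 C : C \in cycles e -> #|R :&: cover C| <= 2.
  by case/cyclesP=> c' Cc' ->; rewrite cover_cycle_edges general_position_cycle.
have leL : #|R :&: leaves| <= #|leaves| := subset_leq_card (subsetIr _ _).
have leC : \sum_(C in cycles e) #|R :&: cover C| <= \sum_(C in cycles e) 2.
  exact: leq_sum.
have sumE : #|leaves| + \sum_(C in cycles e) 2 =
    #|R :&: leaves| + \sum_(C in cycles e) #|R :&: cover C|.
  rewrite -(card_noncut V1 NR) cR cR0 gpE sum_nat_const card_leaves //.
  by rewrite mulnC addnC.
have [LE CE] : #|R :&: leaves| = #|leaves| /\
    \sum_(C in cycles e) #|R :&: cover C| = \sum_(C in cycles e) 2.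
  by move: leL leC sumE; clear; lia.
apply: (good_of_full gR NR R4 _ _ Cc).
  by apply/setIidPr/eqP; rewrite eqEcard subsetIr LE leqnn.
move=> C CC; apply/eqP; rewrite eqn_leq le2 // leqNgt; apply/negP => lt2.
suff : \sum_(C in cycles e) #|R :&: cover C| < \sum_(C in cycles e) 2.
  by rewrite CE ltnn.
rewrite (bigD1 C) //= [X in _ < X](bigD1 C) //= -addSn leq_add //.
by apply: leq_sum => C' /andP[/le2].
Qed.

(** * Graphs with one cycle and at most one pendant edge *)

Lemma cycle_card c : is_cycle e c -> 2 < #|V|.
Proof.
case/and3P=> szc _ Uc; apply: leq_trans szc _.
by rewrite -(card_uniqP Uc) max_card.
Qed.

(** A branch contains a leaf or another cycle. *)
Lemma unique_cycle_leaf c z :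
    #|cycles e| = 1 -> is_cycle e c -> z \in c -> cut_vertex e z ->
  exists2 v, v \in leaves & gate c v = z.
Proof.
move=> k1 Cc zc cz; have V1 := ltnW (cycle_card Cc).
have [v [gv vz Ncv]] := branch_noncut Cc zc cz.
exists v => //; rewrite inE; apply: contraT => dv.
have [|c2 C2 v2] := noncut_on_cycle Ncv.
  by move: (degree_gt0 v V1) dv; case: (degree e v) => [|[]].
have E : cycle_edges c2 = cycle_edges c.
  have /card_le1_eqP eqC : #|cycles e| <= 1 by rewrite k1.
  by apply: eqC; apply/cyclesP; [exists c | exists c2].
have : v \in cover (cycle_edges c) by rewrite -E cover_cycle_edges inE.
by rewrite cover_cycle_edges inE -(gate_eq_mem Cc) gv eq_sym (negPf vz).
Qed.

Lemma good_one_leaf c :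
  #|cycles e| = 1 -> #|leaves| = 1 -> is_cycle e c -> good_cycle e c.
Proof.
move=> k1 t1 Cc; have /and3P[_ _ Uc] := Cc.
have /eqP/cards1P[v Lv] := t1.
have vL : v \in leaves by rewrite Lv set11.
have vc : v \notin c.
  have := leaf_not_cover vL (C := cycle_edges c).
  by rewrite cover_cycle_edges inE; apply; apply/cyclesP; exists c.
have cgv : cut_vertex e (gate c v).
  by apply: (cut_on_cycle Cc); rewrite gate_eq_mem.
apply/orP; left; rewrite /end_block.
rewrite (eq_in_count (a2 := pred1 (gate c v))) => [|z zc /=].
  by rewrite count_uniq_mem // gate_mem.
apply/idP/eqP => [cz|->//].
by have [u] := unique_cycle_leaf k1 Cc zc cz; rewrite Lv => /set1P->.
Qed.

(** The gate of a vertex outside [c] is a cut vertex. *)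
Lemma mem_cutless_cycle c x :
  is_cycle e c -> {in c, forall z, ~~ cut_vertex e z} -> x \in c.
Proof.
move=> Cc Nc; apply: contraT => xc.
have := Nc _ (gate_mem Cc x); rewrite (cut_on_cycle Cc) //.
by rewrite gate_eq_mem.
Qed.

Lemma good_cutless c :
  is_cycle e c -> {in c, forall z, ~~ cut_vertex e z} -> 4 < size c ->
  good_cycle e c.
Proof.
move=> Cc Nc szc; have /and3P[_ _ Uc] := Cc; apply/orP; right.
have D1 : Dc e c <= 1.
  apply/Dc_leP; first exact: leq_trans szc.
  case: (c) szc Uc Nc => [|x [|y s]] // _ Uc Nc; exists x, y.
  rewrite (@left_arc _ x y [::] s) //; split=> //.
  apply/and4P; split; rewrite ?inE ?eqxx ?orbT //.
    by have := Uc; rewrite /= inE negb_or => /andP[/andP[]].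
  apply/allP=> z /Nc/negPf->; exact: implyFb.
by case: ifP => sz; move: D1 szc sz; clear; lia.
Qed.

Lemma gp_cutless_ge3 c :
  is_cycle e c -> {in c, forall z, ~~ cut_vertex e z} -> 4 < size c ->
  2 < gp e.
Proof.
move=> Cc Nc szc.
have [x0 x0c] : exists x0, x0 \in c.
  by case: (c) szc => // x0 q _; exists x0; apply: mem_head.
(* Of the three arcs between the places 0, h and 2h, each is shorter than the
   other two together. *)
pose h := (size c).-1./2; pose f i := nth x0 c i.
have lh : h.*2 < size c by rewrite /h; move: szc; clear; lia.
have hl : size c <= h.*2 + 2 by rewrite /h; move: szc; clear; lia.
have h2 : 1 < h by rewrite /h; move: szc; clear; lia.
have p0 : pos c (f 0) = 0 by apply: pos_nth => //; apply: leq_trans lh.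
have p1 : pos c (f h) = h by apply: pos_nth => //; move: lh; clear; lia.
have p2 : pos c (f h.*2) = h.*2 by apply: pos_nth.
have gpT : general_position e [set f 0; f h; f h.*2].
  have posT x : x \in [set f 0; f h; f h.*2] ->
      pos c x = 0 \/ pos c x = h \/ pos c x = h.*2.
    rewrite !inE => /orP[/orP[]|] /eqP->; rewrite ?p0 ?p1 ?p2; auto.
  have allc x := mem_cutless_cycle x Cc Nc.
  have neq x y : x != y -> pos c x != pos c y by rewrite eq_pos // !gate_id.
  apply/general_positionP => x y z /posT px /posT py /posT pz.
  move=> /neq xy /neq yz /neq xz; apply/negP => /(between_cdist Cc (allc y)).
  move: (pos c x) (pos c y) (pos c z) px py pz xy yz xz.
  rewrite /cdist => i j k; case=> [|[]]-> [|[]]-> [|[]]->;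
    rewrite ?eqxx // => _ _ _; move: lh hl h2; clear; lia.
apply: leq_trans (card_le_gp gpT); apply/card_gt2P.
exists (f 0), (f h), (f h.*2); rewrite !inE !eqxx !orbT; split=> //.
have fneq i j : pos c (f i) != pos c (f j) -> f i != f j.
  by apply: contraNneq => ->.
by split; apply: fneq; rewrite ?p0 ?p1 ?p2; move: h2; clear; lia.
Qed.

Lemma gp_C4 c :
  is_cycle e c -> {in c, forall z, ~~ cut_vertex e z} -> size c = 4 ->
  gp e <= 2.
Proof.
move=> Cc Nc sz4; have [R /general_positionP gpR <-] := gp_attained.
have allc x := mem_cutless_cycle x Cc Nc.
rewrite leqNgt; apply/negP=> /card_gt2P[x [y [z [[xR yR zR] [xy yz zx]]]]].
have neq u v : u != v -> pos c u != pos c v by rewrite eq_pos // !gate_id.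
have B u v t : u \in R -> v \in R -> t \in R -> u != v -> v != t -> u != t ->
    cdist c (pos c u) (pos c v) + cdist c (pos c v) (pos c t) !=
    cdist c (pos c u) (pos c t).
  move=> uR vR tR uv vt ut; apply: contra (gpR u v t uR vR tR uv vt ut).
  move/eqP; apply: (cdist_between Cc) => //; rewrite -eq_pos //; exact: neq.
have xz : x != z by rewrite eq_sym.
have yx : y != x by rewrite eq_sym.
have := B x y z xR yR zR xy yz xz; have := B y z x yR zR xR yz zx yx.
have zy : z != y by rewrite eq_sym.
have := B z x y zR xR yR zx xy zy.
have := neq x y xy; have := neq y z yz; have := neq z x zx.
have := pos_lt Cc x; have := pos_lt Cc y; have := pos_lt Cc z.
rewrite /cdist sz4; move: (pos c x) (pos c y) (pos c z).
by case=> [|[|[|[|]]]] //; case=> [|[|[|[|]]]] //; case=> [|[|[|[|]]]].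
Qed.

End CactusGraph.

Theorem theorem2p5 (V : finType) (e : rel V) (n t k : nat)
  (esym : symmetric e) (eirr : irreflexive e)
  (HG : cactus_class e n t k) :
  gp e <= maxn 3 (2 * k + t) /\
  (* The two exclusions say that G is neither a path (where gp G <= 2 although
     all cycles are vacuously good) nor C_3 (where gp G = 3 although D_c = 1 > 0);
     the equivalence fails exactly for these graphs. *)
  (~ (k = 0 /\ t <= 2) -> ~ (n = 3 /\ k = 1) ->
    (gp e = maxn 3 (2 * k + t) <->
     forall c : seq V, is_cycle e c -> good_cycle e c)).
Proof.
have [[conn _ disj] nE kE tE] := HG.
have gp_le_max : gp e <= maxn 3 (2 * k + t).
  have [V2 | V2] := leqP #|V| 2.
    have [R _ <-] := gp_attained esym conn.
    by rewrite leq_max (leq_trans (max_card R)) // ltnW.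
  by have := gp_le esym eirr conn disj V2; rewrite kE tE.
split=> // not_path not_C3.
have V2 : 2 < #|V|.
  rewrite ltnNge; apply/negP => V2; apply: not_path; split.
    rewrite -kE; apply: eq_card0 => C; apply/negP => /cyclesP[c Cc _].
    by have := cycle_card Cc; rewrite ltnNge V2.
  rewrite -tE; apply: (@leq_trans #|[set [set: V]]|); last by rewrite cards1.
  apply: subset_leq_card; apply/subsetP => E.
  rewrite !inE => /andP[/edgesP[x [y [exy ->]]] _].
  rewrite eqEcard subsetT cardsT cards2.
  by case: eqVneq exy => [->|]; rewrite ?eirr.
have leavesE := card_leaves esym conn V2; rewrite tE in leavesE.
(* Without leaves and other cycles no branch can hang on c. *)
have cutless c : k = 1 -> t = 0 -> is_cycle e c ->
    {in c, forall z, ~~ cut_vertex e z}.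
  move=> k1 t0 Cc z zc; apply/negP => cz; rewrite k1 in kE.
  have [v] := unique_cycle_leaf esym eirr conn disj kE Cc zc cz.
  by rewrite (cards0_eq (etrans leavesE t0)) inE.
split=> [gpE c Cc|good].
  have [big|small] := ltnP 3 (2 * k + t).
    have {}gpE : gp e = 2 * k + t by rewrite gpE; apply/maxn_idPr/ltnW.
    by apply: (good_of_gp esym eirr conn disj _ _ Cc); rewrite gpE ?kE ?tE.
  have k0 : 0 < k.
    rewrite -kE; apply/card_gt0P; exists (cycle_edges c).
    by apply/cyclesP; exists c.
  have k1 : k = 1 by move: k0 small; clear; lia.
  have [t0|t0] := eqVneq t 0; last first.
    have t1 : t = 1 by move: small t0; rewrite k1; clear; lia.
    by apply: (good_one_leaf esym eirr conn disj) Cc; rewrite ?leavesE ?kE.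
  have Nc := cutless c k1 t0 Cc.
  have nc : size c = n.
    have /and3P[_ _ /card_uniqP <-] := Cc; rewrite -nE -cardsT.
    apply: eq_card => x; rewrite inE.
    exact: (mem_cutless_cycle esym conn disj x Cc Nc).
  apply: (good_cutless Cc Nc).
  have szc : 2 < size c by case/andP: Cc.
  have n3 : size c <> 3 by rewrite nc => n3; apply: not_C3.
  have n4 : size c <> 4.
    move=> sz4; have := gp_C4 esym eirr conn disj Cc Nc sz4.
    by rewrite gpE k1 t0.
  by move: szc n3 n4; clear; lia.
have [R gR cR] := good_general_position esym eirr conn disj (ltnW V2) good.
have gp_ge : 2 * k + t <= gp e.
  by rewrite addnC -leavesE -kE -cR; apply: card_le_gp.
apply/eqP; rewrite eqn_leq gp_le_max geq_max gp_ge andbT.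
have [big|small] := leqP 3 (2 * k + t); first exact: leq_trans gp_ge.
have [k1 t0] : k = 1 /\ t = 0.
  case: (posnP k) => [k0|k0]; last by move: k0 small; clear; lia.
  by case: not_path; split; rewrite // -ltnS; move: small; rewrite k0.
have [C] : exists C, C \in cycles e by apply/card_gt0P; rewrite kE k1.
case/cyclesP=> c Cc _; have Nc := cutless c k1 t0 Cc.
apply: (gp_cutless_ge3 esym eirr conn disj Cc Nc).
have [i [m [lm _ m0]]] := good_cycle_arc Cc (good c Cc).
have [/m0[z zc cz]|] := eqVneq m 0; first by rewrite (negPf (Nc z zc)) in cz.
by move: lm; clear; lia.
Qed.
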